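(* There is an absolute constant $C$ such that the following holds. Let $v_0\in\mathbb{R}^n$ be a unit vector, $\epsilon>0$, $\tau\ge C n^{3/4}(\log n)^{1/4}/\epsilon$, and $\mathbf{A}$ an $n\times n\times n$ tensor with independent $\mathcal{N}(0,1)$ entries; let $\mathbf{T}=\tau v_0^{\otimes 3}+\mathbf{A}$ with slices $(T_i)_{jk}=\mathbf{T}_{ijk}$. Let $w\in\mathbb{R}^{n^2}$ be the flattening of $\mathrm{Id}_{n\times n}$, let $v'$ be a top (left or right) singular vector of $M=\sum_i T_i\otimes T_i-n\,ww^T$, let $V'\in\mathbb{R}^{n\times n}$ be its folding $V'_{jk}=v'_{(j,k)}$, and let $v$ be a unit top singular vector of $V'$. Then with probability $1-O(n^{-10})$, $\langle v,v_0\rangle^2\ge 1-O(\epsilon)$.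
   Context: $(A\otimes B)[(j,k),(j',k')]=A_{jj'}B_{kk'}$; $n\,ww^T=\mathbb{E}\sum_iA_i\otimes A_i$ for the Gaussian slices $A_i$. *)

(* Defs.v *)
From HB Require Import structures.
From mathcomp Require Import all_boot all_order all_algebra.
From mathcomp Require Import all_classical all_reals all_analysis.
Set Implicit Arguments. Unset Strict Implicit. Unset Printing Implicit Defensive.
Import Order.TTheory GRing.Theory Num.Theory.
Local Open Scope classical_set_scope.
Local Open Scope ring_scope.

(* Mutual independence of a finite family of real random variables:
   product rule for every family of Borel sets (taking B j = setT recovers
   all subfamilies). *)
Definition mutually_independent d (Omega : measurableType d) (R : realType)
    (P : probability Omega R) (I : finType) (X : I -> {RV P >-> R}) : Prop :=
  forall B : I -> set R, (forall i, measurable (B i)) ->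
    P (\bigcap_(i in [set: I]) (X i @^-1` B i)) =
    (\prod_(i : I) P (X i @^-1` B i))%E.

Definition std_gaussian d (Omega : measurableType d) (R : realType)
    (P : probability Omega R) (X : {RV P >-> R}) : Prop :=
  forall B : set R, measurable B -> distribution P X B = normal_prob 0 1 B.

Definition sqnorm (R : pzRingType) (m : nat) (x : 'cV[R]_m) : R :=
  \sum_(i < m) x i 0 ^+ 2.
Definition dotv (R : pzRingType) (m : nat) (x y : 'cV[R]_m) : R :=
  \sum_(i < m) x i 0 * y i 0.

Definition top_singular_pair (R : realType) (p q : nat) (M : 'M[R]_(p, q))
    (s : R) (u : 'cV[R]_p) (w : 'cV[R]_q) : Prop :=
  [/\ 0 <= s, sqnorm u = 1, sqnorm w = 1,
      M *m w = s *: u /\ M^T *m u = s *: w &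
      forall x : 'cV[R]_q, sqnorm x = 1 -> sqnorm (M *m x) <= s ^+ 2].

Definition top_singular_vector (R : realType) (p : nat) (M : 'M[R]_p)
    (v : 'cV[R]_p) : Prop :=
  exists s (u : 'cV[R]_p), top_singular_pair M s v u \/ top_singular_pair M s u v.

Definition kron (R : pzRingType) (n : nat) (A B : 'M[R]_n) : 'M[R]_(n * n) :=
  \sum_(j < n) \sum_(k < n) \sum_(j' < n) \sum_(k' < n)
     (A j j' * B k k') *: delta_mx (mxvec_index j k) (mxvec_index j' k').

Definition fold_vec (R : pzRingType) (n : nat) (v : 'cV[R]_(n * n)) : 'M[R]_n :=
  vec_mx v^T.

Definition flat_id (R : pzRingType) (n : nat) : 'cV[R]_(n * n) :=
  (mxvec (1%:M : 'M[R]_n))^T.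

Definition spiked_slice (R : pzRingType) (n : nat) (tau : R) (v0 : 'cV[R]_n)
    (A : 'I_n -> 'I_n -> 'I_n -> R) (i : 'I_n) : 'M[R]_n :=
  \matrix_(j, k) (tau * v0 i 0 * v0 j 0 * v0 k 0 + A i j k).

Definition spectral_matrix (R : pzRingType) (n : nat) (Ts : 'I_n -> 'M[R]_n)
    : 'M[R]_(n * n) :=
  \sum_(i < n) kron (Ts i) (Ts i) - n%:R *: (flat_id R n *m (flat_id R n)^T).

(* Main.v *)
(* Write x = v0 (x) v0. Then M = tau^2 x x^T + E, where E is the sum of
   tau (v0 v0^T (x) A_v + A_v (x) v0 v0^T), with A_v = sum_i v0_i A_i, and of the
   centred noise Z = sum_i A_i (x) A_i - n w w^T. Once |E| <= c eps tau^2, a top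
   singular vector of M has squared correlation 1 - O(eps) with x, and a top
   singular vector of its folding inherits a squared correlation 1 - O(eps)
   with v0.

   |A_v| = O(sqrt n) follows from a net. For Z, the bound O(n^(3/2) sqrt(log n))
   is obtained as follows. Terms of Z pairing an entry of A_i with itself form an
   n x n block of centred chi-square sums. The others are 4 times the average over
   masks S of [n] x [n] of Z_S = sum_i (A_i restricted to S) (x) (A_i restricted to
   the complement). Gaussian entries are invariant under sign flips, so the signs
   inside S can be averaged out with the entries frozen, and a matrix Khintchine
   inequality for Rademacher sums bounds the moments of Z_S of order 2p, p ~ log n,
   by (4 p sigma^2)^p; here sigma^2 = O(n^3) on the event that rows and columns of
   each A_i have norm O(sqrt n) and that, for all masks, the n x n^2 and n^2 x n
   flattenings of the masked tensor have norm O(n). The latter event costs a union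
   bound over 2^(n^2) masks and nets of size 2^O(n^2) only. *)
Require Import Defs.
From HB Require Import structures.
From mathcomp Require Import all_boot all_order all_algebra.
From mathcomp Require Import all_classical all_reals all_analysis.
From mathcomp Require Import measurable_realfun.
From mathcomp Require Import zify ring lra.
Set Implicit Arguments. Unset Strict Implicit. Unset Printing Implicit Defensive.
Import Order.TTheory GRing.Theory Num.Theory.
Import numFieldNormedType.Exports.
Local Open Scope classical_set_scope.
Local Open Scope ring_scope.

(** * Rademacher matrix Khintchine inequality *)

Section FrobeniusProduct.
Variable R : realFieldType.

(** The obstacle is that each A_i occurs in both Kronecker factors, so signs attached to its entries
    would enter quadratically; putting the two factors on complementary positions makes the sum
    linear in the signs inside the mask. A mask is a set of pairs (j, k) common to all slices, so
    there are only 2^(n^2) of them, and the failure probability exp(-c n^2) of a flattening bound of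
    order n pays for them all. The moment bound fails with probability of order n^(-10), which could
    not pay for such a union; it is therefore proved for the average over masks, and the average is
    all that the decoupling identity needs.

    Operator norms are reached through Frobenius norms of powers whose exponent is a power of two,
    by repeated Cauchy-Schwarz, and the perturbation arguments evaluate M on explicit test vectors.
    No eigenvalue decomposition or spectral gap enters. Traces of powers are also polynomials in the
    entries, which settles their measurability. *)

Definition fdot (m n : nat) (A B : 'M[R]_(m, n)) : R := \tr (A^T *m B).

Lemma fdotE m n (A B : 'M[R]_(m, n)) : fdot A B = \sum_i \sum_j A i j * B i j.
Proof.
rewrite /fdot exchange_big /=; apply: eq_bigr => j _; rewrite mxE.
by apply: eq_bigr => i _; rewrite mxE.
Qed.

Lemma fdotC m n (A B : 'M[R]_(m, n)) : fdot A B = fdot B A.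
Proof.
by rewrite !fdotE; do 2!(apply: eq_bigr => ? _); rewrite mulrC.
Qed.

Lemma fdotDr m n (A B C : 'M[R]_(m, n)) : fdot A (B + C) = fdot A B + fdot A C.
Proof. by rewrite /fdot mulmxDr mxtraceD. Qed.

Lemma fdotDl m n (A B C : 'M[R]_(m, n)) : fdot (B + C) A = fdot B A + fdot C A.
Proof. by rewrite fdotC fdotDr !(fdotC A). Qed.

Lemma fdotZr m n c (A B : 'M[R]_(m, n)) : fdot A (c *: B) = c * fdot A B.
Proof. by rewrite /fdot -scalemxAr mxtraceZ. Qed.

Lemma fdotZl m n c (A B : 'M[R]_(m, n)) : fdot (c *: A) B = c * fdot A B.
Proof. by rewrite fdotC fdotZr fdotC. Qed.

Lemma fdotNr m n (A B : 'M[R]_(m, n)) : fdot A (- B) = - fdot A B.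
Proof. by rewrite -scaleN1r fdotZr mulN1r. Qed.

Lemma fdotBr m n (A B C : 'M[R]_(m, n)) : fdot A (B - C) = fdot A B - fdot A C.
Proof. by rewrite fdotDr fdotNr. Qed.

Lemma fdotBl m n (A B C : 'M[R]_(m, n)) : fdot (B - C) A = fdot B A - fdot C A.
Proof. by rewrite fdotC fdotBr !(fdotC A). Qed.

Lemma fdot0r m n (A : 'M[R]_(m, n)) : fdot A 0 = 0.
Proof. by rewrite /fdot mulmx0 mxtrace0. Qed.

Lemma fdot_sumr m n (I : finType) (A : 'M[R]_(m, n)) (F : I -> 'M[R]_(m, n)) :
  fdot A (\sum_i F i) = \sum_i fdot A (F i).
Proof. by rewrite /fdot mulmx_sumr raddf_sum. Qed.

Lemma fdot_suml m n (I : finType) (A : 'M[R]_(m, n)) (F : I -> 'M[R]_(m, n)) :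
  fdot (\sum_i F i) A = \sum_i fdot (F i) A.
Proof. by rewrite fdotC fdot_sumr; apply: eq_bigr => i _; rewrite fdotC. Qed.

Lemma fdot_ge0 m n (A : 'M[R]_(m, n)) : 0 <= fdot A A.
Proof. by rewrite fdotE !sumr_ge0// => i _; rewrite sumr_ge0// => j _; rewrite -expr2 sqr_ge0. Qed.

Lemma fdot_tr m n (A B : 'M[R]_(m, n)) : fdot A^T B^T = fdot A B.
Proof. by rewrite /fdot trmxK mxtrace_mulC -[RHS]mxtrace_tr trmx_mul trmxK. Qed.

Lemma fdot_mull m n p (M : 'M[R]_(m, n)) (A : 'M[R]_(n, p)) (B : 'M[R]_(m, p)) :
  fdot (M *m A) B = fdot A (M^T *m B).
Proof. by rewrite /fdot trmx_mul mulmxA. Qed.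

Lemma fdot_mulr m n p (A : 'M[R]_(m, n)) (M : 'M[R]_(n, p)) (B : 'M[R]_(m, p)) :
  fdot (A *m M) B = fdot A (B *m M^T).
Proof. by rewrite -fdot_tr trmx_mul fdot_mull trmxK -fdot_tr trmx_mul !trmxK. Qed.

Lemma fdot_le_avg m n (A B : 'M[R]_(m, n)) : 2 * fdot A B <= fdot A A + fdot B B.
Proof. by have := fdot_ge0 (A - B); rewrite fdotBl !fdotBr (fdotC B A); lra. Qed.

Lemma fdot_cauchy m n (A B : 'M[R]_(m, n)) : fdot A B ^+ 2 <= fdot A A * fdot B B.
Proof.
have [A0|A0] := eqVneq (fdot A A) 0.
  suff -> : fdot A B = 0 by rewrite A0 expr0n mul0r.
  have A00 : A = 0.
    apply/matrixP => i j; rewrite mxE; apply/eqP; rewrite -sqrf_eq0.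
    move: A0; rewrite fdotE => /eqP.
    rewrite psumr_eq0 => [/allP/(_ i)|k _]; last first.
      by rewrite sumr_ge0// => l _; rewrite -expr2 sqr_ge0.
    rewrite mem_index_enum => /(_ isT)/eqP/eqP /=.
    rewrite psumr_eq0 => [/allP/(_ j)|k _]; last by rewrite -expr2 sqr_ge0.
    by rewrite mem_index_enum => /(_ isT); rewrite expr2.
  by rewrite A00 fdotC fdot0r.
have Ap : 0 < fdot A A by rewrite lt_def A0 fdot_ge0.
have := fdot_ge0 (fdot A A *: B - fdot A B *: A).
rewrite fdotBl !fdotBr !fdotZl !fdotZr (fdotC B A) => h.
suff : 0 <= fdot A A * (fdot A A * fdot B B - fdot A B ^+ 2).
  by rewrite pmulr_rge0// subr_ge0.
by apply: le_trans h _; rewrite le_eqVlt; apply/orP; left; apply/eqP; ring.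
Qed.

Lemma fdot_mul_le m n p (A : 'M[R]_(m, n)) (B : 'M[R]_(n, p)) :
  fdot (A *m B) (A *m B) <= fdot A A * fdot B B.
Proof.
rewrite [leLHS]fdotE.
have -> : fdot A A * fdot B B =
    \sum_i \sum_j (\sum_k A i k ^+ 2) * (\sum_k B k j ^+ 2).
  rewrite -(fdot_tr B) !fdotE mulr_suml; apply: eq_bigr => i _.
  rewrite mulr_sumr; apply: eq_bigr => j _.
  by congr (_ * _); apply: eq_bigr => k _; rewrite ?mxE expr2.
apply: ler_sum => i _; apply: ler_sum => j _.
have := fdot_cauchy (row i A) (col j B)^T.
rewrite !fdotE !big_ord_recl !big_ord0 !addr0.
set a := \sum_k _; set b := \sum_k _; set c := \sum_k _ => h.
rewrite -expr2 mxE; apply: le_trans (le_trans h _); rewrite le_eqVlt; apply/orP; left; apply/eqP.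
  by congr (_ ^+ 2); apply: eq_bigr => k _; rewrite !mxE.
by congr (_ * _); apply: eq_bigr => k _; rewrite !mxE expr2.
Qed.

Lemma sqnormE m (x : 'cV[R]_m) : sqnorm x = fdot x x.
Proof. by rewrite fdotE; apply: eq_bigr => i _; rewrite big_ord1 expr2. Qed.

Lemma dotvE m (x y : 'cV[R]_m) : dotv x y = fdot x y.
Proof. by rewrite fdotE; apply: eq_bigr => i _; rewrite big_ord1. Qed.

End FrobeniusProduct.

Section Khintchine.
Variable R : realFieldType.

(** Discrete maximum principle. When the right end moves from r to r+1, convexity at r bounds [g r]
    by the mean of its two neighbours, and the induction hypothesis bounds the left neighbour by
    [g 0] or by [g r] itself. *)
Lemma convex_seq_le (g : nat -> R) r :
  (forall a, (a.+2 <= r)%N -> 2 * g a.+1 <= g a + g a.+2) ->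
  forall a, (a <= r)%N -> g a <= Num.max (g 0%N) (g r).
Proof.
elim: r => [|r IH] gc a ar; first by move: ar; rewrite leqn0 => /eqP->; rewrite le_max lexx.
have {}IH b : (b <= r)%N -> g b <= Num.max (g 0%N) (g r).
  by apply: IH => c cr; apply: gc; apply: leq_trans cr _.
move: ar; rewrite leq_eqVlt => /orP[/eqP->|]; first by rewrite le_max lexx orbT.
rewrite ltnS => ar.
suff gr : g r <= Num.max (g 0%N) (g r.+1).
  by apply: le_trans (IH _ ar) _; rewrite ge_max gr le_max lexx.
case: r IH gc ar => [|r] IH gc ar; first by rewrite le_max lexx.
have h := gc r (leqnn _).
have := IH r (leqnSn r).
by rewrite !le_max => /orP[]; move=> h1; apply/orP; case: (leP (g r.+1) (g 0%N)); [left|right|left|right] => //; lra.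
Qed.

Variable N : nat.
Implicit Types W V K H : 'M[R]_N.

Lemma trmx_exp W p : (W ^+ p)^T = W^T ^+ p.
Proof.
elim: p => [|p IH]; first by rewrite !expr0 trmx1.
by rewrite exprSr exprS [LHS]trmx_mul IH.
Qed.

Lemma fdot_sandwich W V H (a b a' b' : nat) : W^T = W -> V^T = V ->
  fdot (W ^+ a * H * V ^+ b) (W ^+ a' * H * V ^+ b') =
  fdot H (W ^+ (a + a') * H * V ^+ (b' + b)).
Proof.
move=> sW sV; rewrite fdot_mulr trmx_exp sV fdot_mull trmx_exp sW.
by congr fdot; rewrite !mulmxE !exprD !mulrA.
Qed.

(* The squared norms of W^a H V^(r-a) are convex in a, so they are dominated by
   the two endpoint values; odd powers are split into two consecutive terms. *)
Lemma fdot_sandwich_le W V H r q : W^T = W -> V^T = V -> H^T = H -> (q <= r.*2)%N ->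
  fdot H (W ^+ q * H * V ^+ (r.*2 - q)) <=
  fdot (H * V ^+ r) (H * V ^+ r) + fdot (H * W ^+ r) (H * W ^+ r).
Proof.
move=> sW sV sH qr.
pose g a := fdot (W ^+ a * H * V ^+ (r - a)) (W ^+ a * H * V ^+ (r - a)).
have gE a b : (a <= r)%N -> (b <= r)%N ->
    fdot (W ^+ a * H * V ^+ (r - a)) (W ^+ b * H * V ^+ (r - b)) =
    fdot H (W ^+ (a + b) * H * V ^+ (r.*2 - (a + b))).
  move=> ar br; rewrite fdot_sandwich//; congr (fdot _ (_ * V ^+ _)).
  by rewrite -addnn; lia.
have g_le a : (a <= r)%N -> g a <= g 0%N + g r.
  move=> ar.
  have /(_ a ar) : forall a, (a <= r)%N -> g a <= Num.max (g 0%N) (g r).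
    apply: convex_seq_le => {ar}a ar.
    have -> : g a.+1 = fdot (W ^+ a * H * V ^+ (r - a)) (W ^+ a.+2 * H * V ^+ (r - a.+2)).
      by rewrite /g !gE//; do ?(congr (fdot _ (_ ^+ _ * _ * V ^+ _))); lia.
    exact: fdot_le_avg.
  by rewrite le_max => /orP[] h; apply: le_trans h _; rewrite ?lerDl ?lerDr fdot_ge0.
have -> : fdot (H * V ^+ r) (H * V ^+ r) = g 0%N.
  by rewrite /g expr0 mul1r subn0.
have -> : fdot (H * W ^+ r) (H * W ^+ r) = g r.
  rewrite /g subnn expr0 mulr1 -[LHS]fdot_tr !trmx_mul !trmx_exp sH sW.
  by rewrite !mulmxE.
have [qo|qe] := boolP (odd q); last first.
  have qq : q = (q./2 + q./2)%N by rewrite addnn even_halfK.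
  rewrite {1 2}qq -gE; [|lia|lia].
  by apply: g_le; lia.
have qq : q = (q./2 + q./2.+1)%N by rewrite addnS addnn odd_halfK// prednK//; lia.
rewrite {1 2}qq -gE; [|lia|lia].
have := fdot_le_avg (W ^+ q./2 * H * V ^+ (r - q./2)) (W ^+ q./2.+1 * H * V ^+ (r - q./2.+1)).
have := g_le q./2; have := g_le q./2.+1.
rewrite -/(g q./2) -/(g q./2.+1) => h1 h2 h3.
have {}h1 := h1 ltac:(lia); have {}h2 := h2 ltac:(lia).
lra.
Qed.

Lemma exprn_sub_telescope W V m :
  W ^+ m - V ^+ m = \sum_(q < m) W ^+ q * (W - V) * V ^+ (m.-1 - q).
Proof.
elim: m => [|m IH]; first by rewrite big_ord0 !expr0 subrr.
rewrite big_ord_recr /= subnn expr0 mulr1.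
have -> : \sum_(q < m) W ^+ q * (W - V) * V ^+ (m - q) = (W ^+ m - V ^+ m) * V.
  rewrite IH mulr_suml; apply: eq_bigr => q _; rewrite -[RHS]mulrA -exprSr.
  by congr (_ * V ^+ _); have := ltn_ord q; lia.
rewrite mulrBl mulrBr -(exprSr V) -(exprSr W) addrC addrA subrK.
by [].
Qed.

Variables (T : finType) (H : T -> 'M[R]_N).
Hypothesis symH : forall t, (H t)^T = H t.

Definition rademacher_sum (s : {ffun T -> bool}) : 'M[R]_N :=
  \sum_t (-1) ^+ (s t) *: H t.
Local Notation X := rademacher_sum.

Definition flip_at (t : T) (s : {ffun T -> bool}) : {ffun T -> bool} :=
  [ffun u => s u (+) (u == t)].

Lemma flip_atK t : involutive (flip_at t).
Proof. by move=> s; apply/ffunP => u; rewrite !ffunE addbK. Qed.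

Lemma rademacher_sum_sym s : (X s)^T = X s.
Proof. by rewrite /X raddf_sum; apply: eq_bigr => t _ /=; rewrite linearZ /= symH. Qed.

Lemma rademacher_sum_flip t s : X s - X (flip_at t s) = (2 * (-1) ^+ s t) *: H t.
Proof.
rewrite /X (bigD1 t)//= [X in _ - X](bigD1 t)//= !ffunE eqxx addbT.
under [X in _ - (_ + X)]eq_bigr => u ut do rewrite ffunE (negbTE ut) addbF.
rewrite opprD addrACA subrr addr0 -scalerBl; congr (_ *: _).
by case: (s t); rewrite /= ?expr0 ?expr1; ring.
Qed.

Variable sigma2 : R.
Hypothesis varH : forall x : 'cV[R]_N,
  \sum_t sqnorm (H t *m x) <= sigma2 * sqnorm x.

(** [varH] is the vector form of the semidefinite bound of the sum of the H_t^2 by sigma2 times the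
    identity; used on each column of [Y], it takes the Frobenius form needed in the recursion. *)
Lemma variance_mx (Y : 'M[R]_N) :
  \sum_t fdot (H t *m Y) (H t *m Y) <= sigma2 * fdot Y Y.
Proof.
have E (Z : 'M[R]_N) : fdot Z Z = \sum_j sqnorm (col j Z).
  rewrite fdotE exchange_big; apply: eq_bigr => j _; rewrite /sqnorm.
  by apply: eq_bigr => i _; rewrite mxE expr2.
rewrite (eq_bigr _ (fun t _ => E _)) exchange_big E mulr_sumr /=.
apply: ler_sum => j _; apply: le_trans (varH (col j Y)).
by apply: ler_sum => t _; rewrite !colE mulmxA.
Qed.

(* Discrete integration by parts: flipping the sign of t turns the factor H t in
   X^(2p+2) into a telescoping difference of odd powers of X. *)
Lemma khintchine_step p :
  \sum_s fdot (X s ^+ p.+1) (X s ^+ p.+1) <=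
  (2 * (p.*2.+1)%:R * sigma2) * \sum_s fdot (X s ^+ p) (X s ^+ p).
Proof.
pose G t (V : 'M[R]_N) := fdot (H t * V ^+ p) (H t * V ^+ p).
have E (s : {ffun T -> bool}) : fdot (X s ^+ p.+1) (X s ^+ p.+1) =
    \sum_t (-1) ^+ s t * fdot (H t) (X s ^+ p.*2.+1).
  rewrite {1}exprSr [LHS]fdot_mull.
  rewrite trmx_exp rademacher_sum_sym mulmxE -exprD addnS addnn {1}/X fdot_suml.
  by apply: eq_bigr => t _; rewrite fdotZl.
have step t : \sum_(s : {ffun T -> bool}) (-1) ^+ s t * fdot (H t) (X s ^+ p.*2.+1) <=
    2 * (p.*2.+1)%:R * \sum_s G t (X s).
  set S := \sum_s _.
  have S2 : S = \sum_(s : {ffun T -> bool}) - ((-1) ^+ s t * fdot (H t) (X (flip_at t s) ^+ p.*2.+1)).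
    rewrite /S (reindex_inj (inv_inj (flip_atK t))) /=; apply: eq_bigr => s _.
    rewrite ffunE eqxx addbT; case: (s t) => /=; rewrite ?expr0 ?expr1; ring.
  have -> : S = 2^-1 * (S + S) by field.
  rewrite {2}S2 /S -big_split /= mulr_sumr.
  have -> : 2 * (p.*2.+1)%:R * \sum_s G t (X s) =
     \sum_s (p.*2.+1)%:R * (G t (X (flip_at t s)) + G t (X s)).
    have e : \sum_s G t (X s) = \sum_s G t (X (flip_at t s)).
      by rewrite (reindex_inj (inv_inj (flip_atK t))).
    rewrite -mulr_sumr big_split /= -e; ring.
  apply: ler_sum => s _.
  have -> : 2^-1 * ((-1) ^+ s t * fdot (H t) (X s ^+ p.*2.+1)
       - (-1) ^+ s t * fdot (H t) (X (flip_at t s) ^+ p.*2.+1)) =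
     \sum_(q < p.*2.+1) fdot (H t) (X s ^+ q * H t * X (flip_at t s) ^+ (p.*2 - q)).
    rewrite -mulrBr -fdotBr exprn_sub_telescope rademacher_sum_flip fdot_sumr.
    rewrite !mulr_sumr; apply: eq_bigr => q _ /=.
    rewrite -!mulmxE -scalemxAr -scalemxAl fdotZr.
    have : (-1) ^+ s t * (-1) ^+ s t = 1 :> R by rewrite -expr2 sqrr_sign.
    set e := (-1) ^+ s t; set x := fdot _ _ => ee.
    by transitivity (e * e * x); [field | rewrite ee mul1r].
  apply: (@le_trans _ _ (\sum_(q < p.*2.+1) (G t (X (flip_at t s)) + G t (X s)))).
    apply: ler_sum => q _ /=; apply: fdot_sandwich_le; rewrite ?rademacher_sum_sym//.
    by have := ltn_ord q; rewrite ltnS.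
  by rewrite sumr_const card_ord mulr_natl.
rewrite (eq_bigr _ (fun s _ => E s)) exchange_big /=.
apply: le_trans (ler_sum _ (fun t _ => step t)) _.
rewrite -mulr_sumr exchange_big /= -!mulrA ler_pM2l// ler_pM2l ?ltr0n//.
rewrite mulr_sumr; apply: ler_sum => s _; exact: variance_mx.
Qed.

(** The power 0 contributes the squared norm N of the identity, and the step from q to q+1 costs
    2(2q+1) sigma2 <= 4 p sigma2 because q < p. Signs are summed rather than averaged, hence the
    factor 2^#|T|. *)
Lemma khintchine p :
  0 <= sigma2 ->
  \sum_s fdot (X s ^+ p) (X s ^+ p) <=
  (4 * p%:R * sigma2) ^+ p * N%:R * (2 ^ #|T|)%:R.
Proof.
move=> s0.
suff h q : (q <= p)%N -> \sum_s fdot (X s ^+ q) (X s ^+ q) <=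
    (4 * p%:R * sigma2) ^+ q * N%:R * (2 ^ #|T|)%:R by exact: h.
elim: q => [_|q IH qp].
  under eq_bigr do rewrite expr0.
  rewrite sumr_const card_ffun card_bool expr0 mul1r.
  suff -> : fdot (1 : 'M[R]_N) 1 = N%:R by rewrite -[leLHS]mulr_natr lexx.
  by rewrite /fdot trmx1 mul1mx mxtrace1.
apply: le_trans (khintchine_step q) _.
apply: le_trans (ler_wpM2l _ (IH (ltnW qp))) _.
  by rewrite mulr_ge0// mulr_ge0.
rewrite exprS -2!(mulrA (4 * p%:R * sigma2)). apply: ler_wpM2r.
  by rewrite !mulr_ge0 ?exprn_ge0 ?mulr_ge0.
apply: ler_wpM2r => //.
rewrite -[2]/(2%:R) -[4]/(4%:R) -!natrM ler_nat; lia.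
Qed.

End Khintchine.

(** By Cauchy-Schwarz, |Xx|^4 = <x, X^2 x>^2 <= |X^2 x|^2 when |x| <= 1, so each squaring of X
    doubles the exponent. This is why moments are taken at powers of two. *)
Lemma sym_sqnorm_pow (R : realFieldType) N (X : 'M[R]_N) (x : 'cV[R]_N) k :
  X^T = X -> sqnorm x <= 1 ->
  sqnorm (X *m x) ^+ (2 ^ k) <= fdot (X ^+ (2 ^ k)) (X ^+ (2 ^ k)).
Proof.
move=> sX x1.
apply: (@le_trans _ _ (sqnorm (X ^+ (2 ^ k) *m x))); last first.
  rewrite sqnormE; apply: le_trans (fdot_mul_le _ _) _.
  by rewrite -sqnormE ler_piMr// fdot_ge0.
elim: k => [|k IH]; first by rewrite expn0 !expr1.
rewrite expnS mulnC exprM; apply: (@le_trans _ _ (sqnorm (X ^+ (2 ^ k) *m x) ^+ 2)).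
  rewrite lerXn2r ?nnegrE ?exprn_ge0 ?sqnormE ?fdot_ge0//; by rewrite -!sqnormE.
rewrite sqnormE fdot_mull trmx_exp sX mulmxA mulmxE -exprD addnn -mul2n mulnC.
apply: (le_trans (fdot_cauchy x _)); rewrite -!sqnormE.
by rewrite ler_piMl// sqnormE fdot_ge0.
Qed.

(** * Independent Gaussian families *)

Section IndicatorToFunction.
Context d1 d2 (T1 : measurableType d1) (T2 : measurableType d2) (R : realType).
Variables (mu : {measure set T1 -> \bar R}) (nu : {measure set T2 -> \bar R}).
Variables (Y : T1 -> T2) (mY : measurable_fun setT Y) (G : T1 -> R).
Hypotheses (mG : measurable_fun setT G) (G0 : forall x, 0 <= G x).
Hypothesis indic_eq : forall B, measurable B ->
  (\int[mu]_x (\1_B (Y x) * G x)%:E = nu B)%E.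

Import HBNNSimple.

(** Simple functions and monotone convergence carry the identity from indicators to nonnegative
    functions. The weight [G] is the product of the other factors when independence is exploited,
    and the normal density when [Y] is the identity. *)
Lemma integral_weighted_comp (f : T2 -> R) :
  measurable_fun setT f -> (forall y, 0 <= f y) ->
  (\int[mu]_x (f (Y x) * G x)%:E = \int[nu]_y (f y)%:E)%E.
Proof.
move=> mf f0.
have mf' : measurable_fun setT (EFin \o f) by exact/measurable_EFinP.
pose h := nnsfun_approx measurableT mf'.
have f0' y : setT y -> (0 <= (EFin \o f) y)%E by move=> _; rewrite lee_fin.
have -> : (\int[nu]_y (f y)%:E =
    lim (\int[nu]_y (EFin \o h n) y @[n --> \oo]))%E.
  have fE y : (f y)%:E = lim ((EFin \o h n) y @[n --> \oo]).
    by apply/esym/cvg_lim => //; exact: cvg_nnsfun_approx.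
  under eq_integral do rewrite fE.
  apply: monotone_convergence => //.
  - by move=> n; apply/measurable_EFinP; exact/measurable_funP.
  - by move=> n x Ex //=; rewrite lee_fin.
  - by move=> x Ex a b ab; rewrite lee_fin; exact/lefP/nd_nnsfun_approx.
have -> : (\int[mu]_x (f (Y x) * G x)%:E =
    lim (\int[mu]_x (h n (Y x) * G x)%:E @[n --> \oo]))%E.
  have fE x : (f (Y x) * G x)%:E = lim ((h n (Y x) * G x)%:E @[n --> \oo]).
    apply/esym/cvg_lim => //; under eq_fun do rewrite EFinM.
    rewrite EFinM; apply: cvgeZr => //.
    exact: (@cvg_nnsfun_approx _ _ _ _ measurableT _ mf' f0' (Y x) I).
  under eq_integral do rewrite fE.
  apply: monotone_convergence => //.
  - move=> n; apply/measurable_EFinP; apply: measurable_funM => //.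
    by apply: measurableT_comp => //; exact: measurable_funP.
  - by move=> n x _; rewrite lee_fin mulr_ge0.
  - move=> x _ a b ab; rewrite lee_fin ler_wpM2r//.
    by have /lefP := nd_nnsfun_approx measurableT mf' ab; apply.
suff suf n : (\int[mu]_x (h n (Y x) * G x)%:E = \int[nu]_y (EFin \o h n) y)%E.
  by under eq_fun do rewrite suf.
transitivity (\sum_(y \in range (h n)) \int[nu]_x (y * \1_(h n @^-1` [set y]) x)%:E)%E; last first.
  rewrite -ge0_integral_fsum//.
  - by apply: eq_integral => x _; rewrite fsumEFin// -fimfunE.
  - by move=> r; exact/measurable_EFinP/measurable_funM.
  - by move=> r x _; rewrite nnfun_muleindic_ge0.
have mhn y : measurable (h n @^-1` [set y]) by [].
transitivity (\sum_(y \in range (h n)) \int[mu]_x (y * \1_(h n @^-1` [set y]) (Y x) * G x)%:E)%E.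
  rewrite -ge0_integral_fsum//.
  - apply: eq_integral => x _; rewrite [h n (Y x)]fimfunE fsumEFin//; congr EFin.
    by rewrite !fsbig_finite//= mulr_suml.
  - move=> r; apply/measurable_EFinP; apply: measurable_funM => //.
    apply: measurable_funM => //.
    by apply: (measurableT_comp _ mY) => //; exact: measurable_indic.
  - move=> r x _; rewrite lee_fin mulr_ge0//.
    by have := nnfun_muleindic_ge0 (h n) r (Y x); rewrite lee_fin.
apply: eq_fsbigr => r; rewrite inE => -[y _ hr].
have r0 : 0 <= r by rewrite -hr.
under eq_integral do rewrite -mulrA EFinM.
rewrite ge0_integralZl//=; first last.
- by move=> x _; rewrite lee_fin mulr_ge0.
- apply/measurable_EFinP; apply: measurable_funM => //.
  by apply: (measurableT_comp _ mY) => //; exact: measurable_indic.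
rewrite indic_eq//; under [RHS]eq_integral do rewrite EFinM.
rewrite ge0_integralZl//=; first by rewrite integral_indic// setIT.
exact/measurable_EFinP/measurable_indic.
Qed.

End IndicatorToFunction.

Section IndependentProducts.
Context d (Omega : measurableType d) (R : realType) (P : probability Omega R).
Variables (I : finType) (X : I -> {RV P >-> R}).
Hypothesis indepX : mutually_independent X.
Variables (f : I -> R -> R) (c : I -> R).
Hypotheses (mf : forall i, measurable_fun setT (f i)) (f0 : forall i x, 0 <= f i x).
Hypothesis fc : forall i, (\int[P]_w (f i (X i w))%:E = (c i)%:E)%E.

Let mXi i : measurable_fun setT (X i).
Proof. exact: measurable_funPT. Qed.

(* Interpolates between the product rule for events ([s] empty) and the one for
   functions ([s] everything). *)
Let mixed_integral (s : seq I) (B : I -> set R) :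
  uniq s -> (forall i, measurable (B i)) ->
  (\int[P]_w (\prod_i (if i \in s then f i (X i w) else \1_(B i) (X i w)))%:E =
   (\prod_i (if i \in s then c i else fine (P (X i @^-1` B i))))%:E)%E.
Proof.
have mXB i A : measurable A -> measurable (X i @^-1` A).
  by move=> mA; rewrite -[_ @^-1` _]setTI; exact: (mXi i).
have c0 i : 0 <= c i.
  by rewrite -lee_fin -fc integral_ge0// => w _; rewrite lee_fin.
elim: s B => [|i0 s IH] B us mB.
  have -> : (fun w => (\prod_i (if i \in [::] then f i (X i w) else \1_(B i) (X i w)))%:E) =
      (fun w => (\1_(\bigcap_(i in [set: I]) (X i @^-1` B i)) w)%:E).
    apply/funext => w; congr EFin.
    transitivity (\prod_i (\1_(B i) (X i w) : R)); first exact: eq_bigr.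
    have [h|h] := pselect (forall i, B i (X i w)).
      rewrite [RHS]indicE mem_set; last by move=> i _; exact: h.
      by rewrite big1// => i _; rewrite indicE mem_set.
    rewrite [RHS]indicE memNset; last by move=> h'; apply: h => i; exact: h'.
    move/existsNP : h => [i hi]; rewrite (bigD1 i)//= indicE memNset//.
    by rewrite mul0r.
  rewrite integral_indic//; last first.
    by apply: fin_bigcap_measurable => // i _; exact: mXB.
  rewrite setIT; apply: (eq_trans (indepX mB)); rewrite -prodEFin; apply: eq_bigr => i _.
  by rewrite /= fineK// fin_num_measure//; exact: mXB.
move: us => /= /andP[i0s us].
pose G w := \prod_(i | i != i0) (if i \in s then f i (X i w) else \1_(B i) (X i w)).
pose k := \prod_(i | i != i0) (if i \in s then c i else fine (P (X i @^-1` B i))).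
have k0 : 0 <= k by apply: prodr_ge0 => i _; case: ifP => // _; exact: fine_ge0.
have -> : (fun w => (\prod_i (if i \in i0 :: s then f i (X i w) else \1_(B i) (X i w)))%:E) =
    (fun w => (f i0 (X i0 w) * G w)%:E).
  apply/funext => w; rewrite (bigD1 i0)//= mem_head; congr (_ * _)%:E.
  by apply: eq_bigr => i ii0; rewrite in_cons (negbTE ii0).
have -> : (\prod_i (if i \in i0 :: s then c i else fine (P (X i @^-1` B i)))) = k * c i0.
  rewrite (bigD1 i0)//= mem_head mulrC; congr (_ * _).
  by apply: eq_bigr => i ii0; rewrite in_cons (negbTE ii0).
(* The induction hypothesis, with an arbitrary set [A] at [i0], says that the law of [X i0] weighted
   by the other factors is [k] times its own law; this permits replacing the indicator at [i0] by
   [f i0]. *)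
have indic_eq A : measurable A ->
    (\int[P]_w (\1_A (X i0 w) * G w)%:E = mscale (NngNum k0) (distribution P (X i0)) A)%E.
  move=> mA.
  have := IH (fun i => if i == i0 then A else B i) us.
  have -> : (fun w => (\prod_i (if i \in s then f i (X i w) else
       \1_(if i == i0 then A else B i) (X i w)))%:E) = (fun w => (\1_A (X i0 w) * G w)%:E).
    apply/funext => w; rewrite (bigD1 i0)//= (negbTE i0s) eqxx; congr (_ * _)%:E.
    by apply: eq_bigr => i /negbTE->.
  move=> ->; last by move=> i; case: ifP.
  rewrite (bigD1 i0)//= (negbTE i0s) eqxx mulrC EFinM fineK; last first.
    by rewrite fin_num_measure//; exact: mXB.
  rewrite /mscale /=; congr (_%:E * _)%E.
  by apply: eq_bigr => i /negbTE->.
rewrite (@integral_weighted_comp _ _ _ _ _ _ _ (X i0) (mXi i0) G _ _ indic_eq)//.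
- rewrite ge0_integral_mscale//=; last 2 first.
  + exact/measurable_EFinP.
  + by move=> x _; rewrite lee_fin.
  rewrite ge0_integral_distribution//=; last 2 first.
  + exact/measurable_EFinP.
  + by move=> x; rewrite lee_fin.
  by rewrite fc.
- rewrite (_ : G = (fun w => \prod_i (if i != i0 then
      if i \in s then f i (X i w) else \1_(B i) (X i w) else 1))); last first.
    by apply/funext => w; exact: big_mkcond.
  apply: measurable_prod => i _; case: (i != i0); last exact: measurable_cst.
  case: (i \in s); first exact: measurableT_comp.
  by apply: (measurableT_comp _ (mXi i)); exact: measurable_indic.
- by move=> w; apply: prodr_ge0 => i _; case: ifP => _.
Qed.

Lemma integral_prod_independent :
  (\int[P]_w (\prod_i f i (X i w))%:E = (\prod_i c i)%:E)%E.
Proof.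
have := @mixed_integral (enum I) (fun=> set0) (enum_uniq _) (fun=> measurable0).
under eq_integral do under eq_bigr do rewrite mem_enum.
by under [X in _ = X%:E -> _]eq_bigr do rewrite mem_enum.
Qed.

End IndependentProducts.

Section GaussianIntegrals.
Context d (Omega : measurableType d) (R : realType) (P : probability Omega R).
Variables (X : {RV P >-> R}) (gX : std_gaussian X).

Lemma gaussian_integral (f : R -> R) :
  measurable_fun setT f -> (forall x, 0 <= f x) ->
  (\int[P]_w (f (X w))%:E =
   \int[lebesgue_measure]_x (f x * normal_pdf 0 1 x)%:E)%E.
Proof.
move=> mf f0.
have indic_eq (B : set R) : measurable B ->
    (\int[lebesgue_measure]_x (\1_B x * normal_pdf 0 1 x)%:E = distribution P X B)%E.
  move=> mB; rewrite gX// /normal_prob [RHS]integral_mkcond.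
  by apply: eq_integral => x _; rewrite epatch_indic /= -EFinM mulrC.
have mid : @measurable_fun _ _ (measurableTypeR R) R setT (fun x => x).
  exact: measurable_id.
rewrite (@integral_weighted_comp _ _ (measurableTypeR R) R R lebesgue_measure
  (distribution P X) _ mid (normal_pdf 0 1) _ _ indic_eq)//.
- rewrite (@ge0_integral_distribution _ _ _ _ _ _ _ (EFin \o f))//.
  exact/measurable_EFinP.
- exact: measurable_normal_pdf.
- exact: normal_pdf_ge0.
Qed.

(** Completing the square: exp(c x) times the standard density is exp(c^2/2) times the density of
    mean c. *)
Lemma gaussian_mgf (c : R) :
  (\int[P]_w (expR (c * X w))%:E = (expR (c ^+ 2 / 2))%:E)%E.
Proof.
rewrite (@gaussian_integral (fun x => expR (c * x))); first last.
- by move=> x; exact: expR_ge0.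
- by apply: measurableT_comp => //; exact: measurable_funM.
transitivity (\int[lebesgue_measure]_x
    ((expR (c ^+ 2 / 2))%:E * (normal_pdf c 1 x)%:E))%E.
  apply: eq_integral => x _; rewrite -EFinM; congr EFin.
  rewrite !normal_pdfE ?oner_eq0//= mulrCA [RHS]mulrCA; congr (_ * _).
  rewrite /normal_fun -!expRD; congr expR; rewrite subr0 expr1n; by field.
rewrite ge0_integralZl ?lee_fin ?expR_ge0//; first by rewrite integral_normal_pdf mule1.
- by apply/measurable_EFinP; exact: measurable_normal_pdf.
- by move=> x _; rewrite lee_fin normal_pdf_ge0.
Qed.

(** The exponential tilts the standard density into exp(-lam) s times the centred density of
    variance s^2 = 1/(1 - 2 lam), which gives the integral exactly. *)
Lemma gaussian_sq_mgf (lam : R) : `|lam| <= 1/4 ->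
  exists2 c : R, (\int[P]_w (expR (lam * (X w ^+ 2 - 1)))%:E = c%:E)%E &
    c <= expR (4 * lam ^+ 2).
Proof.
rewrite ler_norml => /andP[l1 l2].
pose s2 : R := (1 - 2 * lam)^-1.
have s2p : 0 < s2 by rewrite invr_gt0; lra.
pose s := Num.sqrt s2.
have sp : 0 < s by rewrite sqrtr_gt0.
have ss : s ^+ 2 = s2 by rewrite sqr_sqrtr// ltW.
exists (expR (- lam) * s).
  rewrite (@gaussian_integral (fun x => expR (lam * (x ^+ 2 - 1)))); first last.
  - by move=> x; exact: expR_ge0.
  - apply: measurableT_comp => //; apply: measurable_funM => //.
    by apply: measurable_funB => //; exact: measurable_funX.
  transitivity (\int[lebesgue_measure]_x
      ((expR (- lam) * s)%:E * (normal_pdf 0 s x)%:E))%E.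
    apply: eq_integral => x _; rewrite -EFinM; congr EFin.
    rewrite !normal_pdfE ?oner_eq0 ?gt_eqF//= /normal_peak expr1n mul1r ss.
    rewrite -mulrnAr sqrtrM; last exact: ltW.
    rewrite -/s invfM [RHS]mulrA (mulrA (_ * s)) -(mulrA _ s) divff ?gt_eqF// mulr1 mulrA.
    rewrite mulrAC [RHS]mulrAC; congr (_ * _).
    rewrite /normal_fun -!expRD; congr expR; rewrite subr0 ss expr1n /s2.
    field; lra.
  rewrite ge0_integralZl ?lee_fin ?mulr_ge0 ?expR_ge0 ?(ltW sp)//; first by rewrite integral_normal_pdf mule1.
  - by apply/measurable_EFinP; exact: measurable_normal_pdf.
  - by move=> x _; rewrite lee_fin normal_pdf_ge0.
rewrite mulrC expRN ler_pdivrMr ?expR_gt0// -expRD.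
rewrite -(@ler_pXn2r _ 2)// ?nnegrE ?expR_ge0 ?(ltW sp)// ss -expRM_natl.
(* What remains is (1 - 2 lam)(1 + 2 lam + 8 lam^2) >= 1; the left side exceeds 1 by 4 lam^2 (1 - 4
   lam), hence the range of lam. *)
apply: le_trans (expR_ge1Dx _).
rewrite /s2 -[leLHS]mul1r ler_pdivrMr; last lra.
nra.
Qed.

End GaussianIntegrals.

(** * Joint laws of finite families and invariance under sign flips *)

Section JointLaw.
Variables (R : realType) (I : finType).

(** The boxes generate the product sigma-algebra on real families indexed by a finite type, and they
    are the pi-system on which joint laws are compared. *)
Definition box_system : set (set (I -> R)) :=
  [set A | exists2 B : I -> set R, (forall i, measurable (B i)) &
                                   A = [set x | forall i, B i (x i)]].

Local Notation family_space := (g_sigma_algebraType box_system).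

Lemma box_system_setI : setI_closed box_system.
Proof.
move=> _ _ [B mB ->] [C mC ->]; exists (fun i => B i `&` C i).
  by move=> i; exact: measurableI.
apply/seteqP; split => x /=; first by move=> [h1 h2] i; split.
by move=> h; split=> i; have [] := h i.
Qed.

Lemma measurable_coordinate (i : I) :
  measurable_fun [set: family_space] (fun x : family_space => x i).
Proof.
move=> _ B mB; rewrite setTI; apply: sub_sigma_algebra.
exists (fun j => if j == i then B else setT); first by move=> j; case: ifP.
apply/seteqP; split => x /=; first by move=> h j; case: eqP => // ->.
by move=> /(_ i); rewrite eqxx.
Qed.

Context d (Omega : measurableType d) (P : probability Omega R).

Lemma measurable_family (X : I -> {RV P >-> R}) :
  @measurable_fun _ _ Omega family_space setT (fun w => (fun i => X i w)).
Proof.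
refine (@measurability _ _ Omega family_space setT _ box_system erefl _) => // _ [_ [B mB ->] <-].
rewrite setTI (_ : _ @^-1` _ = \bigcap_(i in [set: I]) (X i @^-1` B i)).
  apply: fin_bigcap_measurable => // i _.
  by rewrite -[_ @^-1` _]setTI; apply: measurable_funPT.
by apply/seteqP; split => w /= h i; [move=> _|]; exact: h.
Qed.

(** Boxes are stable under intersection and include the whole space, so two joint laws that agree on
    them are equal, and so are the integrals against them. *)
Lemma integral_same_joint_law (X Y : I -> {RV P >-> R}) :
  (forall B : I -> set R, (forall i, measurable (B i)) ->
    P (\bigcap_(i in [set: I]) (X i @^-1` B i)) =
    P (\bigcap_(i in [set: I]) (Y i @^-1` B i))) ->
  forall F : family_space -> R, measurable_fun setT F -> (forall x, 0 <= F x) ->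
  (\int[P]_w (F (fun i => X i w))%:E = \int[P]_w (F (fun i => Y i w))%:E)%E.
Proof.
move=> XY F mF F0.
have mX := measurable_family X; have mY := measurable_family Y.
have mF' : measurable_fun setT (EFin \o F) by exact/measurable_EFinP.
have F0' : {in setT, forall x, (0 <= (EFin \o F) x)%E} by move=> x _ /=; rewrite lee_fin.
have hX := @ge0_integral_pushforward _ _ _ _ _ _ mX P setT (EFin \o F) measurableT mF' F0'.
have hY := @ge0_integral_pushforward _ _ _ _ _ _ mY P setT (EFin \o F) measurableT mF' F0'.
rewrite !preimage_setT /= in hX hY.
rewrite -hX -hY.
apply: eq_measure_integral => A mA _.
refine (@measure_unique _ R family_space box_system (fun=> setT) _ _ _ _ _ _ _ _ A mA) => //.
- exact: box_system_setI.
- move=> _; exists (fun=> setT) => //.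
  by apply/seteqP; split.
- by apply/seteqP; split => // x _; exists 0%N.
- move=> _ [B mB ->]; rewrite /= /pushforward.
  have e (Z : I -> {RV P >-> R}) : (fun w => (fun i => Z i w) : family_space) @^-1` [set x | forall i, B i (x i)] = \bigcap_(i in [set: I]) (Z i @^-1` B i).
    by apply/seteqP; split => w /= h i; [move=> _|]; exact: h.
  by rewrite !e XY.
- move=> _; rewrite /= /pushforward preimage_setT probability_setT; exact: ltry.
Qed.

End JointLaw.

Section SignInvariance.
Context d (Omega : measurableType d) (R : realType) (P : probability Omega R).

Lemma normal_prob_opp (B : set R) : measurable B ->
  normal_prob 0 1 (-%R @^-1` B) = normal_prob 0 1 B :> \bar R.
Proof.
move=> mB; rewrite /normal_prob.
have mN : measurable_fun [set: measurableTypeR R] (-%R : measurableTypeR R -> measurableTypeR R).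
  exact: oppr_measurable.
have mpdf : measurable_fun B (fun x : measurableTypeR R => (normal_pdf 0 1 x)%:E).
  by apply: measurable_funTS; apply/measurable_EFinP; exact: measurable_normal_pdf.
transitivity (\int[pushforward lebesgue_measure (-%R : _ -> measurableTypeR R)]_(x in B)
   (normal_pdf 0 1 x)%:E)%E.
  rewrite (ge0_integral_pushforward mN)//=; last by move=> x _; rewrite lee_fin normal_pdf_ge0.
  apply: eq_integral => x _; congr EFin.
  by rewrite !normal_pdfE ?oner_eq0//= /normal_fun !subr0 sqrrN.
apply: eq_measure_integral => A mA _; exact: lebesgue_measureN.
Qed.

Variables (I : finType) (X : I -> {RV P >-> R}).
Hypothesis indepX : mutually_independent X.
Hypothesis gX : forall i, std_gaussian (X i).

Definition signed_rv (s : {ffun I -> bool}) (i : I) : {RV P >-> R} :=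
  if s i then (- X i)%R else X i.

Lemma signed_rvE s i w : signed_rv s i w = (-1) ^+ s i * X i w.
Proof. by rewrite /signed_rv; case: (s i); rewrite /= ?expr1 ?mulN1r ?expr0 ?mul1r. Qed.

(** On a box, independence factors the probability, and the evenness of the normal law absorbs the
    reflection of each flipped side. *)
Lemma integral_sign_invariant (s : {ffun I -> bool}) (F : g_sigma_algebraType (@box_system R I) -> R) :
  measurable_fun setT F -> (forall x, 0 <= F x) ->
  (\int[P]_w (F (fun i => X i w))%:E =
   \int[P]_w (F (fun i => (-1) ^+ s i * X i w))%:E)%E.
Proof.
move=> mF F0.
have -> : (fun w => (F (fun i => (-1) ^+ s i * X i w))%:E) =
    (fun w => (F (fun i => signed_rv s i w))%:E).
  apply/funext => w; congr (F _)%:E; apply/funext => i; by rewrite signed_rvE.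
apply: integral_same_joint_law => // B mB.
have mNB (C : set R) : measurable C -> measurable (-%R @^-1` C).
  by move=> mC; rewrite -[_ @^-1` _]setTI; apply: oppr_measurable.
have -> : \bigcap_(i in [set: I]) (signed_rv s i @^-1` B i) =
   \bigcap_(i in [set: I]) (X i @^-1` (if s i then -%R @^-1` B i else B i)).
  by apply: eq_bigcapr => i _; rewrite /signed_rv; case: (s i).
rewrite !indepX//; last by move=> i; case: (s i) => //; exact: mNB.
apply: eq_bigr => i _; case: (s i) => //.
have := gX i (mB i); rewrite /distribution /pushforward /= => ->.
have := gX i (mNB _ (mB i)); rewrite /distribution /pushforward /= => ->.
by rewrite normal_prob_opp.
Qed.

End SignInvariance.

(** * Chernoff bounds for linear forms and sums of squares *)

Section TailBounds.
Context d (Omega : measurableType d) (R : realType) (P : probability Omega R).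

Lemma measurable_ge_set (Y : Omega -> R) a : measurable_fun setT Y ->
  measurable [set w | a <= Y w].
Proof.
move=> mY; rewrite -[X in measurable X]setTI.
have -> : [set w | a <= Y w] = Y @^-1` `[a, +oo[%classic.
  by apply/seteqP; split => w /=; rewrite in_itv/= andbT.
exact: mY.
Qed.

Lemma markov_ge0 (Y : Omega -> R) (a c : R) :
  measurable_fun setT Y -> (forall w, 0 <= Y w) -> 0 < a ->
  (\int[P]_w (Y w)%:E <= c%:E)%E -> (P [set w | (a <= Y w)%R] <= (c / a)%:E)%E.
Proof.
move=> mY Y0 a0 Yc; have mA := measurable_ge_set a mY.
rewrite mulrC EFinM lee_pdivlMl//; apply: le_trans Yc.
have mI : measurable_fun setT (fun w => (\1_[set w | (a <= Y w)%R] w)%:E : \bar R).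
  by apply/measurable_EFinP; exact: measurable_indic.
rewrite -[X in P X]setIT -integral_indic// -ge0_integralZl ?lee_fin ?(ltW a0)//.
apply: ge0_le_integral => //.
- by move=> w _; rewrite -EFinM lee_fin mulr_ge0 ?(ltW a0)// indicE.
- exact: measurable_funeM.
- exact/measurable_EFinP.
- move=> w _; rewrite -EFinM lee_fin indicE; case: (boolP (w \in _)) => [/set_mem /= h|_]; rewrite ?mulr1 ?mulr0//.
Qed.

Lemma chernoff_ge (Y : Omega -> R) (t c : R) :
  measurable_fun setT Y -> (\int[P]_w (expR (Y w))%:E <= (expR c)%:E)%E ->
  (P [set w | (t <= Y w)%R] <= (expR (c - t))%:E)%E.
Proof.
move=> mY Yc.
have -> : [set w | t <= Y w] = [set w | expR t <= expR (Y w)].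
  by apply/seteqP; split => w /=; rewrite ler_expR.
rewrite expRD expRN; apply: markov_ge0 => //; [exact: measurableT_comp | exact: expR_gt0].
Qed.

Lemma union_bound (T : finType) (E : T -> set Omega) (c : R) :
  (forall a, measurable (E a)) -> (forall a, P (E a) <= c%:E)%E ->
  (P [set w | exists a, E a w] <= (#|T|%:R * c)%:E)%E.
Proof.
move=> mE Ec.
have h (s : seq T) : measurable [set w | exists2 a, a \in s & E a w] /\
    (P [set w | exists2 a, a \in s & E a w] <= ((size s)%:R * c)%:E)%E.
  elim: s => [|a s [mS IH]].
    have -> : [set w | exists2 a, a \in [::] & E a w] = set0.
      by apply/seteqP; split => w // [].
    by rewrite measure0 mul0r; split.
  have -> : [set w | exists2 b, b \in a :: s & E b w] =
      E a `|` [set w | exists2 b, b \in s & E b w].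
    apply/seteqP; split => w.
      move=> [b]; rewrite in_cons => /orP[/eqP->|bs] Eb; [by left|right; by exists b].
    move=> [Ea|[b bs Eb]]; first by exists a; rewrite ?mem_head.
    by exists b; rewrite // in_cons bs orbT.
  split; first exact: measurableU.
  apply: le_trans (measureU2 _ (mE a) mS) _.
  by rewrite /= -natr1 addrC mulrDl mul1r EFinD leeD.
have [_] := h (enum T); rewrite -cardT.
congr (P _ <= _)%E; apply/seteqP; split => w /=.
  by move=> [a _ Ea]; exists a.
by move=> [a Ea]; exists a; rewrite ?mem_enum.
Qed.

Lemma measurable_exists (T : finType) (E : T -> set Omega) :
  (forall a, measurable (E a)) -> measurable [set w | exists a, E a w].
Proof.
move=> mE; have -> : [set w | exists a, E a w] = \bigcup_(a in [set: T]) E a.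
  by apply/seteqP; split => w /= [a]; [exists a|exists a].
by apply: fin_bigcup_measurable => // a _; exact: mE.
Qed.

Variables (I : finType) (X : I -> {RV P >-> R}).
Hypothesis indepX : mutually_independent X.
Hypothesis gX : forall i, std_gaussian (X i).

Lemma measurable_linear_form (c : I -> R) :
  measurable_fun setT (fun w => \sum_i c i * X i w).
Proof. by apply: measurable_sum => i; apply: measurable_funM. Qed.

Lemma linear_form_tail (c : I -> R) (v lam t : R) :
  \sum_i c i ^+ 2 <= v -> 0 < lam ->
  (P [set w | (t <= \sum_i c i * X i w)%R] <= (expR (lam ^+ 2 * v / 2 - lam * t))%:E)%E.
Proof.
move=> cv l0.
have e w : \sum_i (lam * c i) * X i w = lam * \sum_i c i * X i w.
  by rewrite mulr_sumr; apply: eq_bigr => i _; rewrite mulrA.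
have -> : [set w | (t <= \sum_i c i * X i w)%R] =
   [set w | (lam * t <= \sum_i (lam * c i) * X i w)%R].
  by apply/seteqP; split => w /=; rewrite e ler_pM2l.
apply: chernoff_ge; first exact: measurable_linear_form.
have -> : (fun w => (expR (\sum_i lam * c i * X i w))%:E) =
   (fun w => (\prod_i expR (lam * c i * X i w))%:E).
  by apply/funext => w; rewrite expR_sum.
rewrite (integral_prod_independent indepX (f := fun i x => expR (lam * c i * x))
   (c := fun i => expR ((lam * c i) ^+ 2 / 2))).
- rewrite lee_fin -expR_sum ler_expR -mulr_suml ler_pM2r//.
  under eq_bigr do rewrite exprMn.
  by rewrite -mulr_sumr ler_pM2l// exprn_gt0.
- by move=> i; apply: measurableT_comp => //; exact: measurable_funM.
- by move=> i x; exact: expR_ge0.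
- by move=> i; exact: gaussian_mgf.
Qed.

(** [lam] may have either sign, so both the upper and the lower deviation of the sum are covered. *)
Lemma square_sum_tail (D : {pred I}) (lam t : R) : `|lam| <= 1/4 ->
  (P [set w | (t <= lam * \sum_(i in D) (X i w ^+ 2 - 1))%R] <=
   (expR (4 * lam ^+ 2 * #|D|%:R - t))%:E)%E.
Proof.
move=> l1; apply: chernoff_ge.
  apply: measurable_funM => //; rewrite (_ : (fun x => \sum_(i in D) (X i x ^+ 2 - 1)) =
      (fun w => \sum_i (if i \in D then X i w ^+ 2 - 1 else 0))); last first.
    by apply/funext => w; exact: big_mkcond.
  apply: measurable_sum => i; case: (i \in D); last exact: measurable_cst.
  by apply: measurable_funB => //; apply: measurable_funX.
have /choice[c hc] : forall i, exists c : R,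
    (\int[P]_w (expR (lam * (X i w ^+ 2 - 1)))%:E = c%:E)%E /\ c <= expR (4 * lam ^+ 2).
  by move=> i; have [c h1 h2] := gaussian_sq_mgf (gX i) l1; exists c.
have c0 i : 0 <= c i.
  by rewrite -lee_fin -(hc i).1 integral_ge0// => w _; rewrite lee_fin expR_ge0.
have -> : (fun w => (expR (lam * \sum_(i in D) (X i w ^+ 2 - 1)))%:E) =
   (fun w => (\prod_i (if i \in D then expR (lam * (X i w ^+ 2 - 1)) else 1))%:E).
  by apply/funext => w; rewrite -big_mkcond mulr_sumr expR_sum.
rewrite (integral_prod_independent indepX
   (f := fun i x => if i \in D then expR (lam * (x ^+ 2 - 1)) else 1)
   (c := fun i => if i \in D then c i else 1)).
- rewrite lee_fin -big_mkcond.
  apply: (@le_trans _ _ (\prod_(i in D) expR (4 * lam ^+ 2))).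
    by apply: ler_prod => i _; rewrite c0 (hc i).2.
  by rewrite prodr_const -expRM_natl mulrC.
- move=> i; case: (i \in D); last exact: measurable_cst.
  apply: measurableT_comp => //; apply: measurable_funM => //.
  by apply: measurable_funB => //; exact: measurable_funX.
- by move=> i x; case: ifP => // _; exact: expR_ge0.
- move=> i; case: (i \in D); first exact: (hc i).1.
  by rewrite integral_cst// mul1e; exact: probability_setT.
Qed.

End TailBounds.

(** * Nets and operator norms *)

Section Net.
Variable R : realType.

(** Two geometric series around the index M. The exponent is |k - M|, since one of the two truncated
    differences always vanishes. *)
Lemma sum_half_pow_dist M :
  \sum_(k < M.*2.+1) (1/2 : R) ^+ ((k - M) + (M - k)) <= 3 - 2 * (1/2) ^+ M.
Proof.
elim: M => [|M IH]; first by rewrite big_ord1 expr0; lra.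
rewrite doubleS big_ord_recl big_ord_recr /=.
have -> : (bump 0 M.*2.+1 - M.+1 + (M.+1 - bump 0 M.*2.+1) = M.+1)%N.
  by rewrite /bump /=; lia.
have -> : (0 - M.+1 + (M.+1 - 0) = M.+1)%N by lia.
have -> : \sum_(i < M.*2.+1) (1/2 : R) ^+ (bump 0 i - M.+1 + (M.+1 - bump 0 i)) =
   \sum_(k < M.*2.+1) (1/2 : R) ^+ ((k - M) + (M - k)).
  by apply: eq_bigr => i _; congr (_ ^+ _); rewrite /bump /=; lia.
by rewrite exprS; lra.
Qed.

Definition lattice_int (M : nat) (k : 'I_(M.*2.+1)) : int := k%:Z - M%:Z.

(* Weigh every lattice point z by 2^(L - |z|_1), which is at least 1 on the
   counted set since |z|_1 is at most |z|_2^2 for integer vectors. *)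
Lemma lattice_count (J : finType) (M L : nat) :
  (#|[pred z : {ffun J -> 'I_(M.*2.+1)} |
      \sum_j (absz (lattice_int (z j))) ^ 2 <= L]| <= 2 ^ L * 3 ^ #|J|)%N.
Proof.
rewrite -(ler_nat R) natrM !natrX -sum1_card natr_sum.
have dist k : absz (@lattice_int M k) = ((k - M) + (M - k))%N.
  by rewrite /lattice_int; lia.
apply: (@le_trans _ _ (\sum_(z : {ffun J -> 'I_(M.*2.+1)})
   2 ^+ L * \prod_j (1/2 : R) ^+ (absz (lattice_int (z j))))).
  rewrite [leRHS](bigID (fun z : {ffun J -> 'I_(M.*2.+1)} =>
    (\sum_j (absz (lattice_int (z j))) ^ 2 <= L)%N)) /=.
  rewrite -[leLHS]addr0; apply: lerD; last first.
    apply: sumr_ge0 => z _; rewrite mulr_ge0 ?exprn_ge0//; apply: prodr_ge0 => j _.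
    by rewrite exprn_ge0.
  apply: ler_sum => z; rewrite inE => hz.
  have e : 2 ^+ L * (1/2) ^+ L = 1 :> R.
    by rewrite -exprMn (_ : 2 * (1/2) = 1) ?expr1n//; field.
  rewrite prodrXr -{1}e ler_wpM2l ?exprn_ge0//.
  apply: ler_wiXn2l; [lra|lra|].
  by apply: leq_trans hz; apply: leq_sum => j _; nia.
rewrite -mulr_sumr ler_wpM2l ?exprn_ge0//.
rewrite -(bigA_distr_bigA (fun j k => (1/2 : R) ^+ (absz (@lattice_int M k)))) /=.
rewrite prodr_const; apply: lerXn2r; rewrite ?nnegrE//.
  by apply: sumr_ge0 => k _; rewrite exprn_ge0.
under eq_bigr do rewrite dist.
apply: le_trans (sum_half_pow_dist M) _.
have : 0 <= (1/2 : R) ^+ M by rewrite exprn_ge0.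
lra.
Qed.

(** The net consists of the points of the lattice of mesh 1/(4 sqrt d) in a ball. Rounding down
    moves each coordinate by at most the mesh, so the squared distance is at most d/(16 d). *)
Lemma ball_net (J : finType) :
  exists (T : finType) (f : T -> J -> R),
    [/\ (#|T| <= 2 ^ (36 * #|J|))%N,
        (forall t, \sum_j f t j ^+ 2 <= 4) &
        (forall x : J -> R, \sum_j x j ^+ 2 <= 1 ->
           exists t, \sum_j (x j - f t j) ^+ 2 <= 1/16)].
Proof.
have [J0|Jp] := posnP #|J|.
  exists unit, (fun _ _ => 0); split; first by rewrite card_unit expn_gt0.
    by move=> _; rewrite big1// => j _; rewrite expr0n.
  move=> x _; exists tt; rewrite big1 ?divr_ge0// => j _.
  by have := card0_eq J0 j; rewrite inE.
set dd := #|J| in Jp *.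
(* A rounded coordinate has square at most 2 (4 q x_j)^2 + 2, and these add up to at most 32 d + 2
   d, which is [L]. Before rounding, |4 q x_j| <= 4 d, so [M] leaves room for the rounding. The
   count 2^(34 d) 3^d is at most 2^(36 d). *)
pose M := (5 * dd)%N; pose L := (34 * dd)%N.
pose q : R := Num.sqrt dd%:R.
have dp : 0 < dd%:R :> R by rewrite ltr0n.
have qp : 0 < q by rewrite sqrtr_gt0.
have qq : q ^+ 2 = dd%:R by rewrite sqr_sqrtr// ltW.
have q1 : 1 <= q.
  by rewrite -(@ler_pXn2r _ 2)// ?nnegrE ?(ltW qp)// qq expr1n ler1n.
have qd : q <= dd%:R by rewrite -qq expr2 ler_peMr// ltW.
pose good := [pred z : {ffun J -> 'I_(M.*2.+1)} |
      (\sum_j (absz (lattice_int (z j))) ^ 2 <= L)%N].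
pose f (z : {z | good z}) j : R := (lattice_int (val z j))%:~R / (4 * q).
have absE (z : int) : ((absz z) ^ 2)%:R = (z%:~R : R) ^+ 2.
  by rewrite natrX; case: z => // n; rewrite NegzE mulrNz sqrrN.
have sumE (z : {ffun J -> 'I_(M.*2.+1)}) :
    (\sum_j (absz (lattice_int (z j))) ^ 2)%N%:R = \sum_j ((lattice_int (z j))%:~R : R) ^+ 2.
  by rewrite natr_sum; apply: eq_bigr => j _; rewrite absE.
exists {z | good z}, f; split.
- rewrite card_sig; apply: leq_trans (lattice_count J M L) _.
  rewrite (_ : 36 * dd = L + 2 * dd)%N; last by rewrite /L; lia.
  by rewrite expnD leq_mul2l; apply/orP; right; rewrite expnM leq_exp2r.
- move=> [z hz]; rewrite /f /=; under eq_bigr do rewrite exprMn exprVn.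
  rewrite -mulr_suml -sumE ler_pdivrMr; last by rewrite exprn_gt0// mulr_gt0.
  rewrite exprMn qq -!natrX -!natrM ler_nat; apply: leq_trans hz _; rewrite /L; lia.
move=> x x1.
have xj j : `|x j| <= 1.
  rewrite -(@ler_pXn2r _ 2)// ?nnegrE// expr1n real_normK ?num_real//.
  apply: le_trans x1; rewrite (bigD1 j)//= lerDl; apply: sumr_ge0 => k _; exact: sqr_ge0.
pose zf j := Num.floor (4 * q * x j).
have zf_le j : (zf j)%:~R <= 4 * q * x j by exact: floor_le.
have zf_gt j : 4 * q * x j < (zf j)%:~R + 1.
  by have := floorD1_gt (4 * q * x j); rewrite intrD.
have zfM j : (- M%:Z <= zf j) && (zf j <= M%:Z).
  have := xj j; rewrite ler_norml => /andP[h1 h2].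
  rewrite -!(ler_int R) mulrNz -![M%:Z%:~R]/(M%:R) /M natrM.
  have := zf_le j; have := zf_gt j => h3 h4.
  have h5 : q * -1 <= q * x j by rewrite ler_pM2l.
  have h6 : q * x j <= q * 1 by rewrite ler_pM2l.
  have h7 : 1 <= dd%:R :> R by rewrite ler1n.
  by apply/andP; split; lra.
pose z : {ffun J -> 'I_(M.*2.+1)} := [ffun j => inord (absz (zf j + M%:Z))].
have zE j : lattice_int (z j) = zf j.
  have /andP[h1 h2] := zfM j.
  rewrite /lattice_int ffunE inordK; last lia.
  lia.
have sqb j : (zf j)%:~R ^+ 2 <= 2 * (4 * q * x j) ^+ 2 + 2 :> R.
  have := zf_le j; have := zf_gt j.
  set a := 4 * q * x j; set b := (zf j)%:~R => h1 h2.
  have h3 : 0 <= (1 - (a - b)) * (1 + (a - b)) by rewrite mulr_ge0; lra.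
  have := sqr_ge0 (a + (a - b)); nra.
have hz : good z.
  rewrite /good /= -(ler_nat R) sumE; under eq_bigr do rewrite zE.
  apply: le_trans (ler_sum _ (fun j _ => sqb j)) _.
  rewrite big_split /= sumr_const -/dd -mulr_sumr.
  under eq_bigr do rewrite exprMn.
  rewrite -mulr_sumr exprMn qq /L natrM.
  have : dd%:R * (\sum_i x i ^+ 2) <= dd%:R * 1 by rewrite ler_pM2l.
  rewrite -[2 *+ dd]mulr_natr; lra.
exists (exist _ z hz); rewrite /f /=.
have e j : (x j - (lattice_int (z j))%:~R / (4 * q)) ^+ 2 <= (16 * dd%:R)^-1.
  rewrite zE (_ : x j - _ = (4 * q * x j - (zf j)%:~R) / (4 * q)); last first.
    by field; rewrite gt_eqF.
  rewrite exprMn exprVn exprMn qq (_ : 4 ^+ 2 = 16); last by ring.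
  rewrite ler_piMl ?invr_ge0 ?mulr_ge0//.
  have := zf_le j; have := zf_gt j; nra.
apply: le_trans (ler_sum _ (fun j _ => e j)) _.
by rewrite sumr_const -/dd -[leLHS]mulr_natr invfM -[leLHS]mulrA mulVf ?gt_eqF// mulr1 div1r.
Qed.

(** Let s be the supremum of the form over pairs of unit balls. Replacing x by a net point costs
    s/4; replacing y then costs 2 s/4, as net points have norm at most 2. So s <= t + 3s/4, that is
    s <= 4t. *)
Lemma bilinear_net_bound (J1 J2 : finType) (B : J1 -> J2 -> R) (T1 T2 : finType)
    (f1 : T1 -> J1 -> R) (f2 : T2 -> J2 -> R) (t : R) :
  (forall a, \sum_j f1 a j ^+ 2 <= 4) ->
  (forall x : J1 -> R, \sum_j x j ^+ 2 <= 1 ->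
           exists a, \sum_j (x j - f1 a j) ^+ 2 <= 1/16) ->
  (forall x : J2 -> R, \sum_j x j ^+ 2 <= 1 ->
           exists a, \sum_j (x j - f2 a j) ^+ 2 <= 1/16) ->
  (forall a b, \sum_i \sum_j f1 a i * f2 b j * B i j <= t) ->
  forall x : J1 -> R, \sum_j (\sum_i x i * B i j) ^+ 2 <= (4 * t) ^+ 2 * \sum_i x i ^+ 2.
Proof.
move=> n1 net1 net2 ht.
pose b (x : J1 -> R) (y : J2 -> R) := \sum_i \sum_j x i * y j * B i j.
have bB x x' y y' : b x y = b x' y' + b (fun i => x i - x' i) y + b x' (fun j => y j - y' j).
  rewrite /b -!big_split; apply: eq_bigr => i _ /=.
  rewrite -!big_split; apply: eq_bigr => j _ /=; ring.
have bZ c c' x y : b (fun i => c * x i) (fun j => c' * y j) = c * c' * b x y.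
  rewrite /b mulr_sumr; apply: eq_bigr => i _.
  rewrite mulr_sumr; apply: eq_bigr => j _; ring.
have sqZ (J : finType) c (x : J -> R) : \sum_j (c * x j) ^+ 2 = c ^+ 2 * \sum_j x j ^+ 2.
  by rewrite mulr_sumr; apply: eq_bigr => j _; rewrite exprMn.
have sq1 (J : finType) (x : J -> R) j : \sum_j x j ^+ 2 <= 1 -> `|x j| <= 1.
  move=> x1; rewrite -(@ler_pXn2r _ 2)// ?nnegrE// expr1n real_normK ?num_real//.
  apply: le_trans x1; rewrite (bigD1 j)//= lerDl; apply: sumr_ge0 => k _; exact: sqr_ge0.
pose S := [set r | exists x y, [/\ \sum_j x j ^+ 2 <= 1, \sum_j y j ^+ 2 <= 1 & r = b x y]].
have zero1 (J : finType) : \sum_(j in J) (0 : R) ^+ 2 <= 1.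
  by rewrite big1// => j _; rewrite expr0n.
have S0 : S !=set0 by exists (b (fun=> 0) (fun=> 0)), (fun=> 0), (fun=> 0); split; rewrite ?zero1.
have Sub : has_ubound S.
  exists (\sum_i \sum_j `|B i j|) => _ [x [y [x1 y1 ->]]].
  apply: ler_sum => i _; apply: ler_sum => j _.
  apply: le_trans (ler_norm _) _; rewrite !normrM ler_piMl// mulr_ile1//; exact: sq1.
have Sle x y : \sum_j x j ^+ 2 <= 1 -> \sum_j y j ^+ 2 <= 1 -> b x y <= sup S.
  by move=> x1 y1; apply: ub_le_sup => //; exists x, y.
have supS : sup S <= 4 * t.
  suff : sup S <= t + 3/4 * sup S by lra.
  apply: ge_sup => // _ [x [y [x1 y1 ->]]].
  have [a ha] := net1 x x1; have [c hc] := net2 y y1.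
  rewrite (bB x (f1 a) y (f2 c)).
  have h1 : b (fun i => x i - f1 a i) y <= 1/4 * sup S.
    have -> : b (fun i => x i - f1 a i) y =
       b (fun i => 1/4 * (4 * (x i - f1 a i))) (fun j => 1 * y j).
      by congr b; apply/funext => i; [field | rewrite mul1r].
    rewrite bZ mulr1; apply: ler_wpM2l; first lra.
    by apply: Sle => //; rewrite sqZ; lra.
  have h2 : b (f1 a) (fun j => y j - f2 c j) <= 1/2 * sup S.
    have -> : b (f1 a) (fun j => y j - f2 c j) =
       b (fun i => 2 * (1/2 * f1 a i)) (fun j => 1/4 * (4 * (y j - f2 c j))).
      by congr b; apply/funext => i; field.
    rewrite bZ (_ : 2 * (1/4) = 1/2); last by field.
    apply: ler_wpM2l; first lra.
    by apply: Sle => //; rewrite sqZ; have := n1 a; lra.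
  have h3 : b (f1 a) (f2 c) <= t by exact: ht.
  lra.
move=> x; set Q := \sum_j _; set N := \sum_i x i ^+ 2.
have N0 : 0 <= N by apply: sumr_ge0 => i _; exact: sqr_ge0.
have Q0 : 0 <= Q by apply: sumr_ge0 => i _; exact: sqr_ge0.
have [/eqP Qz|Qnz] := boolP (Q == 0); first by rewrite Qz mulr_ge0// sqr_ge0.
have [/eqP Nz|Nnz] := boolP (N == 0).
  suff Qz : Q = 0 by rewrite Qz eqxx in Qnz.
  have x0 i : x i = 0.
    apply/eqP; rewrite -sqrf_eq0; move/eqP : Nz; rewrite psumr_eq0 => [/allP/(_ i)|k _].
      by rewrite mem_index_enum => /(_ isT).
    exact: sqr_ge0.
  by rewrite /Q big1// => j _; rewrite big1 ?expr0n// => i _; rewrite x0 mul0r.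
have Np : 0 < N by rewrite lt_def Nnz.
have Qp : 0 < Q by rewrite lt_def Qnz.
pose n := Num.sqrt N; pose q := Num.sqrt Q.
have np : 0 < n by rewrite sqrtr_gt0.
have qp : 0 < q by rewrite sqrtr_gt0.
have nn : n ^+ 2 = N by rewrite sqr_sqrtr.
have qq : q ^+ 2 = Q by rewrite sqr_sqrtr.
(* Duality: paired with its own normalised image, the normalised [x] gives the value q/n. *)
have : b (fun i => n^-1 * x i) (fun j => q^-1 * \sum_i x i * B i j) <= 4 * t.
  apply: le_trans supS; apply: Sle; rewrite sqZ exprVn ?nn ?qq mulVf//.
rewrite bZ.
have -> : b x (fun j => \sum_i x i * B i j) = Q.
  rewrite /b exchange_big /=; apply: eq_bigr => j _.
  rewrite expr2 mulr_sumr; apply: eq_bigr => i _; ring.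
rewrite -qq => h.
have {}h : q <= 4 * t * n.
  rewrite -ler_pdivrMr//; apply: le_trans h; rewrite le_eqVlt; apply/orP; left; apply/eqP.
  by field; rewrite !gt_eqF.
by rewrite -nn -exprMn lerXn2r ?nnegrE ?(ltW qp)//; apply: le_trans h; exact: ltW.
Qed.

End Net.

(** * Kronecker products and decoupling *)

Section KroneckerFold.
Variables (R : realFieldType) (n : nat).
Implicit Types (A B Y : 'M[R]_n) (v : 'cV[R]_(n * n)).

Lemma mxvec_index_eq (i j i' j' : 'I_n) :
  (mxvec_index i j == mxvec_index i' j') = (i == i') && (j == j').
Proof.
apply/eqP/andP => [h|[/eqP-> /eqP->]//].
have inj : injective (fun ij : 'I_n * 'I_n => mxvec_index ij.1 ij.2).
  by have [g gK _] := curry_mxvec_bij n n; apply: (can_inj (g := g)) => -[a b]; exact: (gK (a, b)).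
by have [-> ->] := inj (i, j) (i', j') h.
Qed.

Lemma fold_vecE v i j : fold_vec v i j = v (mxvec_index i j) 0.
Proof. by rewrite /fold_vec mxE mxE. Qed.

Lemma fold_vecD u v : fold_vec (u + v) = fold_vec u + fold_vec v.
Proof. by rewrite /fold_vec !linearD. Qed.

Lemma fold_vecZ c v : fold_vec (c *: v) = c *: fold_vec v.
Proof. by rewrite /fold_vec !linearZ. Qed.

Lemma fold_vecN v : fold_vec (- v) = - fold_vec v.
Proof. by rewrite /fold_vec !linearN. Qed.

Lemma fold_vec_sum (I : finType) (F : I -> 'cV[R]_(n * n)) :
  fold_vec (\sum_i F i) = \sum_i fold_vec (F i).
Proof. by rewrite /fold_vec !linear_sum. Qed.

Lemma big_mxvec (F : 'I_(n * n) -> R) :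
  \sum_x F x = \sum_i \sum_j F (mxvec_index i j).
Proof.
rewrite pair_big /= (reindex (uncurry (@mxvec_index n n))) /=.
  by apply: eq_bigr => -[i j] _.
exact: curry_mxvec_bij.
Qed.

Lemma fdot_fold u v : fdot (fold_vec u) (fold_vec v) = fdot u v.
Proof.
rewrite !fdotE big_mxvec; do 2!(apply: eq_bigr => ? _).
by rewrite big_ord1 !fold_vecE.
Qed.

Lemma kronE A B i j i' j' :
  kron A B (mxvec_index i j) (mxvec_index i' j') = A i i' * B j j'.
Proof.
rewrite /kron summxE (bigD1 i)//= summxE (bigD1 j)//= summxE (bigD1 i')//=.
rewrite summxE (bigD1 j')//= !mxE !eqxx mulr1 !big1 ?addr0//.
- move=> k ki; rewrite summxE big1// => l _; rewrite summxE big1// => k' _.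
  rewrite summxE big1// => l' _; rewrite !mxE !mxvec_index_eq eq_sym (negbTE ki).
  by rewrite mulr0.
- move=> l lj; rewrite summxE big1// => k' _.
  rewrite summxE big1// => l' _; rewrite !mxE !mxvec_index_eq (eq_sym j) (negbTE lj) andbF.
  by rewrite mulr0.
- move=> k' ki; rewrite summxE big1// => l' _.
  by rewrite !mxE !mxvec_index_eq (eq_sym i') (negbTE ki) andbF mulr0.
- move=> l' lj; rewrite !mxE !mxvec_index_eq (eq_sym j') (negbTE lj) andbF.
  by rewrite andbF mulr0.
Qed.

(** Trades an n^2 x n^2 matrix for a two-sided product of n x n matrices, the form in which the
    noise terms are split and estimated. *)
Lemma fold_kron A B v : fold_vec (kron A B *m v) = A *m fold_vec v *m B^T.
Proof.
apply/matrixP => j k; rewrite fold_vecE mxE big_mxvec mxE exchange_big /=.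
apply: eq_bigr => k' _; rewrite !mxE mulr_suml; apply: eq_bigr => j' _.
by rewrite kronE fold_vecE mulrAC.
Qed.

Lemma kron_tr A B : (kron A B)^T = kron A^T B^T.
Proof.
apply/matrixP => x y; rewrite mxE.
case: (mxvec_indexP x) => i j; case: (mxvec_indexP y) => i' j'.
by rewrite !kronE !mxE.
Qed.

Lemma kronZl c A B : kron (c *: A) B = c *: kron A B.
Proof.
apply/matrixP => x y; rewrite mxE.
case: (mxvec_indexP x) => i j; case: (mxvec_indexP y) => i' j'.
by rewrite !kronE !mxE mulrA.
Qed.

Lemma kron_suml (I : finType) (F : I -> 'M[R]_n) B :
  kron (\sum_i F i) B = \sum_i kron (F i) B.
Proof.
apply/matrixP => x y; rewrite [RHS]summxE.
case: (mxvec_indexP x) => i j; case: (mxvec_indexP y) => i' j'.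
by rewrite !kronE summxE mulr_suml; apply: eq_bigr => ? _; rewrite kronE.
Qed.

Lemma fold_flat_id v :
  fold_vec (flat_id R n *m (flat_id R n)^T *m v) = \tr (fold_vec v) *: 1%:M.
Proof.
rewrite -mulmxA; apply/matrixP => j k; rewrite fold_vecE mxE big_ord1 !mxE.
rewrite mxvecE mulrC !mxE; congr (_ * _).
rewrite big_mxvec /mxtrace; apply: eq_bigr => i _; rewrite (bigD1 i)//= big1 ?addr0.
  by rewrite !mxE mxvecE !mxE eqxx mul1r.
by move=> l li; rewrite !mxE mxvecE mxE eq_sym (negbTE li) mul0r.
Qed.

Lemma fold_spectral_matrix (Ts : 'I_n -> 'M[R]_n) v :
  fold_vec (spectral_matrix Ts *m v) =
  \sum_i Ts i *m fold_vec v *m (Ts i)^T - n%:R *: (\tr (fold_vec v) *: 1%:M).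
Proof.
rewrite /spectral_matrix mulmxBl fold_vecD fold_vecN -scalemxAl fold_vecZ fold_flat_id.
by rewrite mulmx_suml fold_vec_sum; under eq_bigr do rewrite fold_kron.
Qed.

End KroneckerFold.

Section SumInequalities.
Variable R : realFieldType.

Lemma sum_cauchy (J : finType) (x y : J -> R) :
  (\sum_j x j * y j) ^+ 2 <= (\sum_j x j ^+ 2) * (\sum_j y j ^+ 2).
Proof.
have : 0 <= \sum_i \sum_j (x i * y j - x j * y i) ^+ 2.
  by apply: sumr_ge0 => i _; apply: sumr_ge0 => j _; exact: sqr_ge0.
have -> : \sum_i \sum_j (x i * y j - x j * y i) ^+ 2 =
  \sum_i \sum_j (x i ^+ 2 * y j ^+ 2) + \sum_i \sum_j (x j ^+ 2 * y i ^+ 2)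
   - 2 * \sum_i \sum_j (x i * y i) * (x j * y j).
  rewrite mulr_sumr -sumrN -!big_split; apply: eq_bigr => i _ /=.
  rewrite mulr_sumr -sumrN -!big_split; apply: eq_bigr => j _ /=; ring.
have e (u v : J -> R) : \sum_i \sum_j u i * v j = (\sum_i u i) * (\sum_j v j).
  by rewrite mulr_suml; apply: eq_bigr => i _; rewrite mulr_sumr.
rewrite [X in _ + X - _]exchange_big /= !e -expr2; lra.
Qed.

Lemma sqr_sum_le (J : finType) (x : J -> R) :
  (\sum_j x j) ^+ 2 <= #|J|%:R * \sum_j x j ^+ 2.
Proof.
have := sum_cauchy (fun=> 1) x; under eq_bigr do rewrite mul1r.
by under [X in _ <= X * _]eq_bigr do rewrite expr1n; rewrite sumr_const.
Qed.

Lemma fdot_sum_le (J : finType) m n (F : J -> 'M[R]_(m, n)) :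
  fdot (\sum_j F j) (\sum_j F j) <= #|J|%:R * \sum_j fdot (F j) (F j).
Proof.
have e (Z : 'M[R]_(m, n)) : fdot Z Z = \sum_p \sum_q Z p q ^+ 2.
  by rewrite fdotE.
rewrite e; under [X in _ <= _ * X]eq_bigr do rewrite e.
rewrite [X in _ <= _ * X]exchange_big mulr_sumr; apply: ler_sum => p _ /=.
rewrite [X in _ <= _ * X]exchange_big mulr_sumr; apply: ler_sum => q _ /=.
by rewrite summxE; exact: sqr_sum_le.
Qed.

(** Jensen's inequality for exponents 2^k, by iterating Cauchy-Schwarz; it brings a bound on
    averaged moments back to averaged squared norms. *)
Lemma power_mean (J : finType) (x : J -> R) k : (0 < #|J|)%N -> (forall j, 0 <= x j) ->
  (#|J|%:R^-1 * \sum_j x j) ^+ (2 ^ k) <= #|J|%:R^-1 * \sum_j x j ^+ (2 ^ k).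
Proof.
move=> J0; have Jp : 0 < #|J|%:R :> R by rewrite ltr0n.
elim: k x => [|k IH] x x0; first by rewrite expn0; under [X in _ <= _ * X]eq_bigr do rewrite expr1.
rewrite expnS exprM; under [X in _ <= _ * X]eq_bigr do rewrite exprM.
apply: le_trans (IH (fun j => x j ^+ 2) _); last by move=> j; exact: sqr_ge0.
apply: lerXn2r; rewrite ?nnegrE ?sqr_ge0//.
  by rewrite mulr_ge0 ?invr_ge0 ?ler0n// sumr_ge0// => j _; exact: sqr_ge0.
rewrite exprMn expr2 -mulrA ler_pM2l ?invr_gt0// -ler_pdivlMl ?invr_gt0// invrK.
exact: sqr_sum_le.
Qed.

End SumInequalities.

Section Decoupling.
Variables (R : realFieldType) (n : nat).
Local Notation I3 := ('I_n * 'I_n * 'I_n)%type.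
Local Notation mask := {ffun 'I_n * 'I_n -> bool}.
Implicit Types (a : I3 -> R) (S : mask) (Y : 'M[R]_n).

Definition tensor_slice a i : 'M[R]_n := \matrix_(j, k) a (i, j, k).
Definition masked_slice S a i : 'M[R]_n := \matrix_(j, k) ((S (j, k))%:R * a (i, j, k)).
Definition compl_mask S : mask := [ffun x => ~~ S x].
Definition decoupled S a : 'M[R]_(n * n) :=
  \sum_i kron (masked_slice S a i) (masked_slice (compl_mask S) a i).
(** Folded action of the chi-square block: it reads only the diagonal of [Y] and writes only on the
    diagonal. *)
Definition diagonal_part a Y : 'M[R]_n :=
  \matrix_(j, k) ((j == k)%:R * \sum_l (\sum_i (a (i, j, l) ^+ 2 - 1)) * Y l l).

(** Flipping a mask at x, or at y, permutes the masks, so the four joint values of (S x, S y) are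
    equally frequent. *)
Lemma mask_count (U : finType) (x y : U) : x != y ->
  4 * \sum_(S : {ffun U -> bool}) ((S x)%:R * (~~ S y)%:R) = (2 ^ #|U|)%:R :> R.
Proof.
move=> xy.
have fx (h : bool -> bool -> R) :
    \sum_(S : {ffun U -> bool}) h (S x) (S y) = \sum_(S : {ffun U -> bool}) h (~~ S x) (S y).
  rewrite (reindex_inj (inv_inj (flip_atK x))) /=; apply: eq_bigr => S _.
  by rewrite !ffunE eqxx eq_sym (negbTE xy) addbT addbF.
have fy (h : bool -> bool -> R) :
    \sum_(S : {ffun U -> bool}) h (S x) (S y) = \sum_(S : {ffun U -> bool}) h (S x) (~~ S y).
  rewrite (reindex_inj (inv_inj (flip_atK y))) /=; apply: eq_bigr => S _.
  by rewrite !ffunE eqxx (negbTE xy) addbT addbF.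
pose h b c : R := b%:R * (~~ c)%:R.
have e1 := fx h; have e2 := fy h; have e3 := fy (fun b c => h (~~ b) c).
transitivity (\sum_(S : {ffun U -> bool}) (1 : R)); last first.
  by rewrite sumr_const card_ffun card_bool.
transitivity (\sum_(S : {ffun U -> bool})
   (h (S x) (S y) + h (~~ S x) (S y) + h (S x) (~~ S y) + h (~~ S x) (~~ S y))).
  rewrite !big_split /= -e2 -e3 -e1 /h; ring.
apply: eq_bigr => S _; rewrite /h.
by case: (S x); case: (S y); rewrite /= ?mulr0 ?mulr1 ?addr0 ?add0r.
Qed.

Lemma mask_count_diag (U : finType) (x : U) :
  \sum_(S : {ffun U -> bool}) ((S x)%:R * (~~ S x)%:R) = 0 :> R.
Proof. by rewrite big1// => S _; case: (S x); rewrite ?mulr0 ?mul0r. Qed.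

(* Two distinct positions are separated by exactly a quarter of all masks, while
   equal positions never are; the latter give the diagonal part. *)
Lemma decoupling a Y :
  \sum_i tensor_slice a i *m Y *m (tensor_slice a i)^T - n%:R *: (\tr Y *: 1%:M) =
  diagonal_part a Y + (4 / (2 ^ (n * n))%:R) *:
   \sum_(S : mask) \sum_i masked_slice S a i *m Y *m (masked_slice (compl_mask S) a i)^T.
Proof.
apply/matrixP => j k.
have lhs : (\sum_i tensor_slice a i *m Y *m (tensor_slice a i)^T) j k =
    \sum_i \sum_k' \sum_j' a (i, j, j') * a (i, k, k') * Y j' k'.
  rewrite summxE; apply: eq_bigr => i _; rewrite mxE; apply: eq_bigr => k' _.
  rewrite !mxE mulr_suml; apply: eq_bigr => j' _; rewrite !mxE; ring.
have rhs : (\sum_(S : mask) \sum_i masked_slice S a i *m Y *m (masked_slice (compl_mask S) a i)^T) j k =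
    \sum_i \sum_k' \sum_j' (a (i, j, j') * a (i, k, k') * Y j' k') *
      \sum_(S : mask) ((S (j, j'))%:R * (~~ S (k, k'))%:R).
  rewrite summxE; under eq_bigr do rewrite summxE; rewrite exchange_big.
  apply: eq_bigr => i _ /=.
  transitivity (\sum_(S : mask) \sum_k' \sum_j' (a (i, j, j') * a (i, k, k') * Y j' k') *
     ((S (j, j'))%:R * (~~ S (k, k'))%:R)).
    apply: eq_bigr => S _; rewrite mxE; apply: eq_bigr => k' _.
    rewrite !mxE mulr_suml; apply: eq_bigr => j' _; rewrite !mxE ffunE; ring.
  rewrite exchange_big; apply: eq_bigr => k' _ /=.
  rewrite exchange_big; apply: eq_bigr => j' _ /=.
  by rewrite mulr_sumr.
have off i k' j' : (a (i, j, j') * a (i, k, k') * Y j' k') =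
   ((j == k) && (j' == k'))%:R * (a (i, j, k') ^+ 2 * Y k' k')
   + 4 / (2 ^ (n * n))%:R * ((a (i, j, j') * a (i, k, k') * Y j' k') *
      \sum_(S : mask) ((S (j, j'))%:R * (~~ S (k, k'))%:R)).
  have [/andP[/eqP-> /eqP->]|ne] := boolP ((j == k) && (j' == k')).
    by rewrite mask_count_diag mulr0 mulr0 addr0 mul1r expr2.
  have := @mask_count _ (j, j') (k, k') ne.
  rewrite card_prod card_ord => h.
  have p0 : (2 ^ (n * n))%:R != 0 :> R by rewrite pnatr_eq0 -lt0n expn_gt0.
  rewrite mul0r add0r; have aux (x s N : R) : 4 * s = N -> N != 0 -> x = 4 / N * (x * s).
    by move=> <- N0; field; apply: contraNN N0 => /eqP->; rewrite mulr0.
  exact: aux h p0.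
rewrite [LHS]mxE lhs [RHS]mxE [X in _ = _ + X]mxE rhs.
under eq_bigr => i _ do under eq_bigr => k' _ do under eq_bigr => j' _ do rewrite off.
under eq_bigr => i _ do under eq_bigr => k' _ do rewrite big_split /=.
under eq_bigr => i _ do rewrite big_split /=.
rewrite big_split /= addrAC; congr (_ + _); last first.
  rewrite mulr_sumr; apply: eq_bigr => i _; rewrite mulr_sumr; apply: eq_bigr => k' _.
  by rewrite mulr_sumr.
have collapse (F : 'I_n -> R) :
    \sum_k' \sum_j' ((j == k) && (j' == k'))%:R * F k' = (j == k)%:R * \sum_k' F k'.
  rewrite mulr_sumr; apply: eq_bigr => k' _; rewrite (bigD1 k')//= eqxx andbT.
  by rewrite big1 ?addr0// => l /negbTE->; rewrite andbF mul0r.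
under eq_bigr => i _ do rewrite collapse.
rewrite !mxE /mxtrace -mulr_sumr; case: (j == k); last by rewrite !(mul0r, mulr0) subr0.
rewrite mulr1 !mul1r mulr_sumr exchange_big -sumrB /=; apply: eq_bigr => l _.
by rewrite sumrB sumr_const card_ord mulrBl mulr_suml.
Qed.

(** Cauchy-Schwarz bounds each diagonal entry squared by n D^2 |Y|^2, and there are n of them. With
    D of order sqrt(n log n), the norm n D is of the same order as the off-diagonal noise. *)
Lemma diagonal_part_bound a Y D : 0 <= D ->
  (forall j l, `|\sum_i (a (i, j, l) ^+ 2 - 1)| <= D) ->
  fdot (diagonal_part a Y) (diagonal_part a Y) <= (n%:R * D) ^+ 2 * fdot Y Y.
Proof.
move=> D0 hD.
have dY : \sum_l Y l l ^+ 2 <= fdot Y Y.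
  rewrite fdotE; apply: ler_sum => l _; rewrite (bigD1 l)//= -expr2 lerDl.
  by apply: sumr_ge0 => k _; rewrite -expr2 sqr_ge0.
have YY := fdot_ge0 Y.
rewrite [leLHS]fdotE exprMn expr2 -!mulrA [leRHS]mulrA.
apply: (@le_trans _ _ (\sum_(j < n) n%:R * (D ^+ 2 * fdot Y Y))); last first.
  by rewrite sumr_const card_ord -[leLHS]mulr_natl !mulrA.
apply: ler_sum => j _; rewrite (bigD1 j)//= big1 => [|k kj]; last first.
  by rewrite !mxE eq_sym (negbTE kj) !mul0r.
rewrite addr0 !mxE eqxx mul1r -expr2.
apply: le_trans (sum_cauchy _ _) _; rewrite mulrA; apply: ler_pM => //.
- by apply: sumr_ge0 => l _; exact: sqr_ge0.
- by apply: sumr_ge0 => l _; exact: sqr_ge0.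
apply: (@le_trans _ _ (\sum_(l < n) D ^+ 2)); last by rewrite sumr_const card_ord mulr_natl.
apply: ler_sum => l _; rewrite -[leLHS]real_normK ?num_real//.
by apply: lerXn2r; rewrite ?nnegrE.
Qed.

End Decoupling.

(** * Khintchine bound for the decoupled matrices *)

Section Dilation.
Variables (R : realFieldType) (N : nat).
Implicit Types M : 'M[R]_N.

(** Hermitian dilation: the decoupled matrix is not symmetric in general, whereas the Khintchine
    argument and the power trick need symmetry. *)
Definition dilation M : 'M[R]_(N + N) := block_mx 0 M M^T 0.

Lemma dilation_sym M : (dilation M)^T = dilation M.
Proof. by rewrite /dilation tr_block_mx !trmx0 trmxK. Qed.

Lemma dilationZ c M : dilation (c *: M) = c *: dilation M.
Proof. by rewrite /dilation scale_block_mx !scaler0 linearZ. Qed.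

Lemma dilation_sum (T : finType) (F : T -> 'M[R]_N) :
  dilation (\sum_t F t) = \sum_t dilation (F t).
Proof.
have dD M M' : dilation (M + M') = dilation M + dilation M'.
  by rewrite /dilation add_block_mx !addr0 linearD.
have d0 : dilation 0 = 0 by rewrite /dilation trmx0 block_mx0.
exact: (big_morph _ dD d0).
Qed.

Lemma sqnorm_dilation M (x y : 'cV[R]_N) :
  sqnorm (dilation M *m col_mx x y) = sqnorm (M *m y) + sqnorm (M^T *m x).
Proof.
rewrite /dilation mul_block_col !mul0mx add0r addr0 /sqnorm big_split_ord /=.
by congr (_ + _); apply: eq_bigr => i _; rewrite ?col_mxEu ?col_mxEd.
Qed.

Lemma sqnorm_col_mx (x y : 'cV[R]_N) : sqnorm (col_mx x y) = sqnorm x + sqnorm y.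
Proof.
rewrite /sqnorm big_split_ord /=.
by congr (_ + _); apply: eq_bigr => i _; rewrite ?col_mxEu ?col_mxEd.
Qed.

Lemma sqnorm_pow_le_dilation M (y : 'cV[R]_N) k : sqnorm y <= 1 ->
  sqnorm (M *m y) ^+ (2 ^ k) <= fdot (dilation M ^+ (2 ^ k)) (dilation M ^+ (2 ^ k)).
Proof.
move=> y1; have z0 : sqnorm (0 : 'cV[R]_N) = 0.
  by rewrite /sqnorm big1// => i _; rewrite mxE expr0n.
have := @sym_sqnorm_pow _ _ (dilation M) (col_mx 0 y) k (dilation_sym M).
rewrite sqnorm_col_mx z0 add0r sqnorm_dilation mulmx0 z0 addr0.
exact.
Qed.

End Dilation.

Lemma sum_triple (V : nmodType) (I J K : finType) (F : I * J * K -> V) :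
  \sum_t F t = \sum_i \sum_j \sum_k F (i, j, k).
Proof. by rewrite pair_big pair_big /=; apply: eq_bigr => -[[i j] k]. Qed.

Section DecoupledKhintchine.
Variables (R : realFieldType) (n : nat).
Local Notation I3 := ('I_n * 'I_n * 'I_n)%type.
Local Notation mask := {ffun 'I_n * 'I_n -> bool}.
Implicit Types (a : I3 -> R) (S : mask).

(** Squared operator norms of the two flattenings of the masked tensor, the one isolating the index
    k and the one isolating j. *)
Definition masked_op_bound (q : R) S a : Prop :=
  (forall y : 'I_n -> R,
     \sum_i \sum_j (\sum_k (S (j, k))%:R * a (i, j, k) * y k) ^+ 2 <= q * \sum_k y k ^+ 2) /\
  (forall x : 'I_n -> R,
     \sum_i \sum_k (\sum_j (S (j, k))%:R * a (i, j, k) * x j) ^+ 2 <= q * \sum_j x j ^+ 2).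

Definition fiber_bound (r : R) a : Prop :=
  (forall i j, \sum_k a (i, j, k) ^+ 2 <= r) /\ (forall i k, \sum_j a (i, j, k) ^+ 2 <= r).

Lemma fdot_delta_mul (j k : 'I_n) (M : 'M[R]_n) :
  fdot (delta_mx j k *m M) (delta_mx j k *m M) = \sum_m M k m ^+ 2.
Proof.
rewrite fdotE (bigD1 j)//= [X in _ + X]big1 => [|p pj]; last first.
  rewrite big1// => m _; rewrite mxE big1 ?mul0r// => l _.
  by rewrite mxE (negbTE pj) mul0r.
rewrite addr0; apply: eq_bigr => m _; rewrite -expr2 mxE (bigD1 k)//= big1.
  by rewrite mxE !eqxx mul1r addr0.
by move=> l lk; rewrite mxE (negbTE lk) andbF mul0r.
Qed.

(** Coefficient matrix of the sign of entry t once all absolute values and the complement are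
    frozen. Entries outside the mask contribute 0, so signs can be indexed by the whole tensor. *)
Definition summand S a (t : I3) : 'M[R]_(n * n + n * n) :=
  ((S (t.1.2, t.2))%:R * a t) *:
     dilation (kron (delta_mx t.1.2 t.2) (masked_slice (compl_mask S) a t.1.1)).

(* Only entries inside the mask change sign, so the right Kronecker factors are
   unaffected. *)
Definition flip_masked S (s : {ffun I3 -> bool}) a (t : I3) : R :=
  (-1) ^+ (s t && S (t.1.2, t.2)) * a t.

Lemma rademacher_summand S a s :
  rademacher_sum (summand S a) s = dilation (decoupled S (flip_masked S s a)).
Proof.
have maskE i : masked_slice (compl_mask S) (flip_masked S s a) i =
    masked_slice (compl_mask S) a i.
  apply/matrixP => j k; rewrite !mxE /flip_masked /= ffunE.
  by case: (S (j, k)); rewrite /= ?mul0r// andbF expr0 !mul1r.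
have sumE i : masked_slice S (flip_masked S s a) i =
    \sum_j \sum_k ((-1) ^+ s (i, j, k) * ((S (j, k))%:R * a (i, j, k))) *: delta_mx j k.
  rewrite [LHS]matrix_sum_delta; apply: eq_bigr => j _; apply: eq_bigr => k _.
  congr (_ *: _); rewrite mxE /flip_masked /=.
  by case: (S (j, k)); rewrite ?andbT ?mul1r// !mul0r mulr0.
rewrite /decoupled; under [in RHS]eq_bigr do rewrite maskE sumE.
rewrite /rademacher_sum dilation_sum sum_triple.
apply: eq_bigr => i _; rewrite kron_suml dilation_sum; apply: eq_bigr => j _.
rewrite kron_suml dilation_sum; apply: eq_bigr => k _.
by rewrite /summand /= kronZl dilationZ scalerA.
Qed.

(** With B_i the complementary slice, [delta_mx j k] selects row k of [Y], so a summand contributes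
    at most a_ijk^2 |B_i Y_k|^2. Summing over j uses a fiber bound, then summing over i a flattening
    bound, and the rows of [Y] add up to its norm. The transposed block is the same with j and k
    exchanged. *)
Lemma summand_variance S a (r q : R) (z : 'cV[R]_(n * n + n * n)) :
  0 <= r -> 0 <= q -> fiber_bound r a -> masked_op_bound q (compl_mask S) a ->
  \sum_t sqnorm (summand S a t *m z) <= (r * q) * sqnorm z.
Proof.
move=> r0 q0 [row_b col_b] [op1 op2].
rewrite -(vsubmxK z); set x := usubmx z; set y := dsubmx z.
pose Q := masked_slice (compl_mask S) a.
pose X := fold_vec x; pose Y := fold_vec y.
have cle (t : I3) : ((S (t.1.2, t.2))%:R * a t) ^+ 2 <= a t ^+ 2.
  by rewrite exprMn; case: (S _); rewrite ?expr1n ?mul1r ?expr0n /= ?mul0r ?sqr_ge0.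
have sqE (t : I3) : sqnorm (summand S a t *m col_mx x y) <=
    a t ^+ 2 * (\sum_m (\sum_l Y t.2 l * Q t.1.1 m l) ^+ 2 +
                \sum_m (\sum_l X t.1.2 l * Q t.1.1 l m) ^+ 2).
  case: t => -[i j] k /=.
  rewrite /summand -dilationZ sqnorm_dilation linearZ /= -!scalemxAl !sqnormE.
  have := cle (i, j, k); rewrite /=; set c := _ * a _ => hc.
  have e (M : 'cV[R]_(n * n)) : fdot (c *: M) (c *: M) = c ^+ 2 * fdot M M by rewrite fdotZl fdotZr mulrA.
  rewrite !e -mulrDr; apply: ler_pM => //.
  - exact: sqr_ge0.
  - by rewrite addr_ge0// fdot_ge0.
  rewrite kron_tr trmx_delta -!fdot_fold !fold_kron -!mulmxA !fdot_delta_mul trmxK.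
  rewrite le_eqVlt; apply/orP; left; apply/eqP.
  by congr (_ + _); apply: eq_bigr => m _; congr (_ ^+ 2); rewrite mxE; apply: eq_bigr => l _; rewrite ?mxE.
apply: le_trans (ler_sum _ (fun t _ => sqE t)) _.
under eq_bigr do rewrite mulrDr.
rewrite big_split !sum_triple sqnorm_col_mx mulrDr addrC /=; apply: lerD; last first.
  apply: (@le_trans _ _ (\sum_i \sum_j r * \sum_m (\sum_l X j l * Q i l m) ^+ 2)).
    apply: ler_sum => i _; apply: ler_sum => j _; rewrite /= -mulr_suml.
    apply: ler_wpM2r => //; apply: sumr_ge0 => m _; exact: sqr_ge0.
  under eq_bigr do rewrite -mulr_sumr.
  rewrite -mulr_sumr -mulrA ler_wpM2l// exchange_big sqnormE -fdot_fold fdotE mulr_sumr.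
  apply: ler_sum => j _ /=; have := op2 (fun l => X j l).
  congr (_ <= _).
  apply: eq_bigr => i _; apply: eq_bigr => m _; congr (_ ^+ 2).
  by apply: eq_bigr => l _; rewrite /Q [masked_slice _ _ _ _ _]mxE mulrC.
apply: (@le_trans _ _ (\sum_i \sum_k r * \sum_m (\sum_l Y k l * Q i m l) ^+ 2)).
  apply: ler_sum => i _; rewrite exchange_big /=; apply: ler_sum => k _; rewrite /= -mulr_suml.
  apply: ler_wpM2r => //; apply: sumr_ge0 => m _; exact: sqr_ge0.
under eq_bigr do rewrite -mulr_sumr.
rewrite -mulr_sumr -mulrA ler_wpM2l// exchange_big sqnormE -fdot_fold fdotE mulr_sumr.
apply: ler_sum => k _ /=; have := op1 (fun l => Y k l).
congr (_ <= _).
apply: eq_bigr => i _; apply: eq_bigr => m _; congr (_ ^+ 2).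
by apply: eq_bigr => l _; rewrite /Q [masked_slice _ _ _ _ _]mxE mulrC.
Qed.

Lemma decoupled_khintchine S a (r q : R) p :
  0 <= r -> 0 <= q -> fiber_bound r a -> masked_op_bound q (compl_mask S) a ->
  \sum_(s : {ffun I3 -> bool})
     fdot (dilation (decoupled S (flip_masked S s a)) ^+ p)
          (dilation (decoupled S (flip_masked S s a)) ^+ p) <=
  (4 * p%:R * (r * q)) ^+ p * (n * n + n * n)%:R * (2 ^ #|{: I3}|)%:R.
Proof.
move=> r0 q0 hr hq.
under eq_bigr do rewrite -rademacher_summand.
apply: khintchine; last by rewrite mulr_ge0.
  by move=> t; rewrite /summand linearZ /= dilation_sym.
by move=> z; exact: summand_variance.
Qed.

End DecoupledKhintchine.

(** * Recovery from singular vectors *)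

Section SingularVectors.
Variable R : realType.

Lemma sqr_fdot_le1 m n (A B : 'M[R]_(m, n)) : fdot A A <= 1 -> fdot B B <= 1 ->
  `|fdot A B| <= 1.
Proof.
move=> A1 B1; rewrite -(@ler_pXn2r _ 2)// ?nnegrE// expr1n real_normK ?num_real//.
apply: le_trans (fdot_cauchy _ _) _; rewrite mulr_ile1 ?fdot_ge0//.
Qed.

(** Testing M at x gives s >= lam - kap, while s = <Mw, u> <= lam |<x,w>| |<x,u>| + kap. With e =
    kap/lam the product of the two correlations is at least 1 - 2e, hence so is each factor c, and
    c^2 >= 2c - 1 >= 1 - 4e. *)
Lemma spiked_singular_pair N (M : 'M[R]_N) (E : 'cV[R]_N -> 'cV[R]_N) (x u w : 'cV[R]_N)
    (lam kap s : R) :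
  (forall y, M *m y = (lam * fdot x y) *: x + E y) ->
  (forall y, fdot y y = 1 -> fdot (E y) (E y) <= kap ^+ 2) ->
  0 < lam -> 0 <= kap -> sqnorm x = 1 -> top_singular_pair M s u w ->
  1 - 4 * (kap / lam) <= fdot x w ^+ 2 /\ 1 - 4 * (kap / lam) <= fdot x u ^+ 2.
Proof.
move=> ME hE l0 k0; rewrite sqnormE => x1 [s0]; rewrite !sqnormE => u1 w1 [Mw _] top.
have Eb y z : fdot y y = 1 -> fdot z z = 1 -> `|fdot (E y) z| <= kap.
  move=> y1 z1; rewrite -(@ler_pXn2r _ 2)// ?nnegrE// real_normK ?num_real//.
  by apply: le_trans (fdot_cauchy _ _) _; rewrite z1 mulr1 hE.
have s_ge : lam - kap <= s.
  have h : fdot (M *m x) x = lam + fdot (E x) x.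
    by rewrite ME fdotDl fdotZl x1 !mulr1.
  have := Eb x x x1 x1; rewrite ler_norml => /andP[h1 _].
  apply: (@le_trans _ _ (fdot (M *m x) x)); first by rewrite h; lra.
  apply: le_trans (ler_norm _) _.
  rewrite -(@ler_pXn2r _ 2)// ?nnegrE// real_normK ?num_real//.
  apply: le_trans (fdot_cauchy _ _) _; rewrite x1 mulr1.
  by have := top x; rewrite !sqnormE; apply.
have s_le : s <= lam * (`|fdot x w| * `|fdot x u|) + kap.
  have -> : s = lam * (fdot x w * fdot x u) + fdot (E w) u.
    transitivity (fdot (M *m w) u); first by rewrite Mw fdotZl u1 mulr1.
    by rewrite ME fdotDl fdotZl !mulrA.
  apply: lerD; last by apply: le_trans (ler_norm _) _; exact: Eb.
  by rewrite ler_pM2l// -normrM ler_norm.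
have xw1 : `|fdot x w| <= 1 by apply: sqr_fdot_le1; rewrite ?x1 ?w1.
have xu1 : `|fdot x u| <= 1 by apply: sqr_fdot_le1; rewrite ?x1 ?u1.
have prod_ge : 1 - 2 * (kap / lam) <= `|fdot x w| * `|fdot x u|.
  rewrite -(@ler_pM2l _ lam)// mulrBr mulr1.
  have -> : lam * (2 * (kap / lam)) = 2 * kap by field; rewrite gt_eqF.
  lra.
have fin (c c' : R) : `|c| <= 1 -> `|c'| <= 1 -> 1 - 2 * (kap / lam) <= `|c| * `|c'| ->
    1 - 4 * (kap / lam) <= c ^+ 2.
  move=> c1 c1' h; set e := kap / lam in h *.
  have e0 : 0 <= e by rewrite divr_ge0// ltW.
  have h2 : 1 - 2 * e <= `|c| by apply: le_trans h _; rewrite ler_piMr.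
  rewrite -real_normK ?num_real//; have := normr_ge0 c; nra.
split; first exact: fin xw1 xu1 prod_ge.
by apply: fin xu1 xw1 _; rewrite [leRHS]mulrC.
Qed.

(** Removing s u w^T from a matrix of Frobenius norm 1 leaves squared norm 1 - s^2 <= del. Hence the
    part z of x orthogonal to w satisfies |Mz|^2 <= del (1 - b^2), and 1 - del <= |Mx|^2 = b^2 s^2 +
    |Mz|^2 with s^2 <= 1 forces b^2 >= 1 - 2 del. *)
Lemma fold_singular_core n (M : 'M[R]_n) (x u w : 'cV[R]_n) (s del : R) :
  0 <= del -> fdot M M = 1 -> fdot x x = 1 -> fdot u u = 1 -> fdot w w = 1 ->
  M *m w = s *: u -> M^T *m u = s *: w -> 1 - del <= s ^+ 2 ->
  1 - del <= fdot (M *m x) x ^+ 2 -> 1 - 2 * del <= fdot w x ^+ 2.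
Proof.
move=> d0 M1 x1 u1 w1 Mw Mu s_ge a_ge.
set b := fdot w x; pose z := x - b *: w.
have wz : fdot w z = 0 by rewrite fdotBr fdotZr w1 mulr1 subrr.
have zz : fdot z z = 1 - b ^+ 2.
  rewrite /z fdotBl !fdotBr !fdotZl !fdotZr x1 w1 (fdotC x) -/b; ring.
pose Q := M - s *: (u *m w^T).
have Muw : fdot M (u *m w^T) = s.
  by rewrite fdotC fdot_mulr trmxK Mw fdotZr u1 mulr1.
have uw1 : fdot (u *m w^T) (u *m w^T) = 1.
  have ww : w^T *m w = 1%:M.
    by apply/matrixP => i j; rewrite !ord1 mxE [RHS]mxE eqxx -[RHS]w1 fdotE; apply: eq_bigr => k _; rewrite big_ord1 mxE.
  by rewrite fdot_mulr trmxK -mulmxA ww mulmx1.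
have QQ : fdot Q Q = 1 - s ^+ 2.
  by rewrite /Q fdotBl !fdotBr !fdotZl !fdotZr M1 (fdotC _ M) Muw uw1; ring.
have s1 : s ^+ 2 <= 1 by have := fdot_ge0 Q; rewrite QQ subr_ge0.
have Qz : Q *m z = M *m z.
  have w0 : w^T *m z = 0.
    apply/matrixP => i j; rewrite !ord1 mxE [RHS]mxE -[RHS]wz fdotE.
    by apply: eq_bigr => k _; rewrite big_ord1 mxE.
  by rewrite mulmxBl -scalemxAl -mulmxA w0 mulmx0 scaler0 subr0.
have Mz : fdot (M *m z) (M *m z) <= del * (1 - b ^+ 2).
  rewrite -Qz -zz; apply: le_trans (fdot_mul_le _ _) _.
  by rewrite ler_wpM2r ?fdot_ge0// QQ; lra.
have Mx : fdot (M *m x) (M *m x) = b ^+ 2 * s ^+ 2 + fdot (M *m z) (M *m z).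
  have -> : M *m x = (b * s) *: u + M *m z.
    by rewrite /z mulmxBr -scalemxAr Mw scalerA addrC subrK.
  have uMz : fdot u (M *m z) = 0.
    by rewrite fdotC fdot_mull fdotC Mu fdotZl wz mulr0.
  by rewrite fdotDl !fdotDr !fdotZl !fdotZr u1 (fdotC (M *m z)) uMz; ring.
have : fdot (M *m x) x ^+ 2 <= fdot (M *m x) (M *m x).
  by apply: le_trans (fdot_cauchy _ _) _; rewrite x1 mulr1.
rewrite Mx; have b2 : 0 <= b ^+ 2 := sqr_ge0 b; nra.
Qed.

Lemma fold_singular_vector n (M : 'M[R]_n) (x v : 'cV[R]_n) (del : R) :
  0 <= del -> fdot M M = 1 -> sqnorm x = 1 -> 1 - del <= fdot (M *m x) x ^+ 2 ->
  top_singular_vector M v -> 1 - 2 * del <= dotv v x ^+ 2.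
Proof.
move=> d0 M1; rewrite sqnormE dotvE => x1 a_ge [s [u]].
have s_ge y y' : top_singular_pair M s y y' -> 1 - del <= s ^+ 2.
  move=> [_ _ _ _ top]; apply: le_trans a_ge _.
  apply: le_trans (fdot_cauchy _ _) _; rewrite x1 mulr1.
  by have := top x; rewrite !sqnormE; apply.
(* The quadratic form does not see transposition, so a left singular vector is treated as a right
   one of the transpose. *)
have ax : fdot (M^T *m x) x = fdot (M *m x) x by rewrite fdot_mull trmxK fdotC.
move=> [] h; have sg := s_ge _ _ h; case: h => _; rewrite !sqnormE => u1 w1 [Mw Mu] _.
  apply: (@fold_singular_core _ M^T x u v s) => //; rewrite ?trmxK// ?ax//.
  by rewrite fdot_tr.
exact: (@fold_singular_core _ M x u v s).
Qed.

End SingularVectors.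

(** * Recovery from deterministic bounds on the noise *)

Section DeterministicRecovery.
Variables (R : realType) (n : nat).
Local Notation I3 := ('I_n * 'I_n * 'I_n)%type.
Local Notation mask := {ffun 'I_n * 'I_n -> bool}.
Variables (a : I3 -> R) (v0 : 'cV[R]_n) (tau : R).
Hypotheses (v01 : sqnorm v0 = 1) (tau0 : 0 < tau).

Lemma fdot_triangle m p (A B : 'M[R]_(m, p)) (k l : R) : 0 <= k -> 0 <= l ->
  fdot A A <= k ^+ 2 -> fdot B B <= l ^+ 2 -> fdot (A + B) (A + B) <= (k + l) ^+ 2.
Proof.
move=> k0 l0 hA hB.
have h : fdot A B <= k * l.
  apply: le_trans (ler_norm _) _; rewrite -(@ler_pXn2r _ 2)// ?nnegrE// ?mulr_ge0//.
  rewrite real_normK ?num_real//; apply: le_trans (fdot_cauchy _ _) _.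
  by rewrite exprMn ler_pM ?fdot_ge0.
by rewrite fdotDl !fdotDr (fdotC B A); lra.
Qed.

Let V : 'M[R]_n := v0 *m v0^T.
Definition spike : 'cV[R]_(n * n) := (mxvec V)^T.
Definition contracted_noise : 'M[R]_n := \sum_i v0 i 0 *: tensor_slice a i.
Let M := spectral_matrix (spiked_slice tau v0 (fun i j k => a (i, j, k))).

Let v0v0 : v0^T *m v0 = 1%:M.
Proof.
apply/matrixP => i j; rewrite !ord1 mxE [RHS]mxE eqxx -[RHS]v01.
by apply: eq_bigr => k _; rewrite mxE expr2.
Qed.

Lemma fold_spike : fold_vec spike = V.
Proof. by rewrite /fold_vec /spike trmxK mxvecK. Qed.

Lemma sqnorm_spike : sqnorm spike = 1.
Proof.
by rewrite sqnormE -fdot_fold fold_spike fdot_mulr trmxK -mulmxA v0v0 mulmx1 -sqnormE.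
Qed.

Lemma spike_sandwich Y : V *m Y *m V = fdot V Y *: V.
Proof.
have -> : V *m Y *m V = v0 *m (v0^T *m Y *m v0) *m v0^T by rewrite /V !mulmxA.
have -> : v0^T *m Y *m v0 = (fdot V Y)%:M.
  by rewrite [LHS]mx11_scalar; congr (_%:M); rewrite /fdot /V trmx_mul trmxK -[in RHS]mulmxA [in RHS]mxtrace_mulC /mxtrace [RHS]big_ord1.
by rewrite mul_mx_scalar -scalemxAl.
Qed.

(** Each slice is tau v0_i V + A_i. Summed over i, the pure spike terms give tau^2 <V,Y> V, the
    mixed terms contract the noise against v0, and the pure noise terms, centred, are what
    [decoupling] rewrites. *)
Lemma fold_spiked_noise (y : 'cV[R]_(n * n)) :
  fold_vec (M *m y - (tau ^+ 2 * fdot spike y) *: spike) =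
  tau *: (V *m fold_vec y *m contracted_noise^T) +
  tau *: (contracted_noise *m fold_vec y *m V) +
  diagonal_part a (fold_vec y) +
  (4 / (2 ^ (n * n))%:R) *: fold_vec (\sum_(S : mask) decoupled S a *m y).
Proof.
have -> : fold_vec (\sum_(S : mask) decoupled S a *m y) =
   \sum_(S : mask) \sum_i masked_slice S a i *m fold_vec y *m (masked_slice (compl_mask S) a i)^T.
  rewrite fold_vec_sum; apply: eq_bigr => S _; rewrite mulmx_suml fold_vec_sum.
  by apply: eq_bigr => i _; rewrite fold_kron.
rewrite -addrA -decoupling fold_vecD fold_vecN fold_vecZ fold_spectral_matrix.
rewrite -(fdot_fold spike) fold_spike; set Y := fold_vec y.
have sl i : spiked_slice tau v0 (fun i j k => a (i, j, k)) i =
    (tau * v0 i 0) *: V + tensor_slice a i.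
  by apply/matrixP => j k; rewrite !mxE big_ord1 !mxE !mulrA.
have Vt : V^T = V by rewrite /V trmx_mul trmxK.
have e i : spiked_slice tau v0 (fun i j k => a (i, j, k)) i *m Y *m
     (spiked_slice tau v0 (fun i j k => a (i, j, k)) i)^T =
   (v0 i 0 ^+ 2) *: ((tau ^+ 2 * fdot V Y) *: V)
   + tau *: (V *m Y *m (v0 i 0 *: tensor_slice a i)^T)
   + tau *: (v0 i 0 *: tensor_slice a i *m Y *m V)
   + tensor_slice a i *m Y *m (tensor_slice a i)^T.
  rewrite sl linearD /= !linearZ /= Vt !mulmxDl !mulmxDr -!scalemxAl -!scalemxAr.
  rewrite spike_sandwich !scalerA !addrA.
  by congr (_ *: _ + _ *: _ + _ *: _ + _); ring.
rewrite (eq_bigr _ (fun i _ => e i)) !big_split /= -scaler_suml.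
have -> : \sum_i v0 i 0 ^+ 2 = 1 by rewrite -v01.
have -> : V *m Y *m contracted_noise^T = \sum_i V *m Y *m (v0 i 0 *: tensor_slice a i)^T.
  by rewrite /contracted_noise linear_sum mulmx_sumr.
have -> : contracted_noise *m Y *m V = \sum_i v0 i 0 *: tensor_slice a i *m Y *m V.
  by rewrite /contracted_noise !mulmx_suml.
rewrite scale1r -!scaler_sumr.
rewrite -!addrA addrC !addrA subrK.
by [].
Qed.

Variables (b D t : R) (k : nat).
Hypotheses (b0 : 0 <= b) (D0 : 0 <= D) (t0 : 0 <= t).
Hypothesis noise_bound : forall z : 'cV[R]_n, fdot z z <= 1 ->
  fdot (contracted_noise *m z) (contracted_noise *m z) <= b ^+ 2.
Hypothesis diag_bound : forall j l, `|\sum_i (a (i, j, l) ^+ 2 - 1)| <= D.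
Hypothesis trace_bound :
  \sum_(S : mask) fdot (dilation (decoupled S a) ^+ (2 ^ k)) (dilation (decoupled S a) ^+ (2 ^ k))
   <= (2 ^ (n * n))%:R * (t ^+ 2) ^+ (2 ^ k).
Let kap := 2 * (tau * b) + n%:R * D + 4 * t.

Let card_mask : #|{: mask}| = (2 ^ (n * n))%N.
Proof. by rewrite card_ffun card_bool card_prod card_ord. Qed.

(** The power mean turns the trace bound into a mean of at most t^2 for the squared norms over all
    masks; Cauchy-Schwarz over the masks then yields (4/N)^2 N (N t^2) = 16 t^2. *)
Lemma decoupled_average_bound (y : 'cV[R]_(n * n)) : fdot y y = 1 ->
  fdot ((4 / (2 ^ (n * n))%:R) *: \sum_(S : mask) decoupled S a *m y)
       ((4 / (2 ^ (n * n))%:R) *: \sum_(S : mask) decoupled S a *m y) <= (4 * t) ^+ 2.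
Proof.
move=> y1; set N := (2 ^ (n * n))%N.
have Np : 0 < N%:R :> R by rewrite ltr0n expn_gt0.
pose q (S : mask) := sqnorm (decoupled S a *m y).
have q0 S : 0 <= q S by rewrite /q sqnormE fdot_ge0.
have avg : N%:R^-1 * \sum_S q S <= t ^+ 2.
  rewrite -(@ler_pXn2r _ (2 ^ k)) ?expn_gt0// ?nnegrE ?sqr_ge0//; last first.
    by rewrite mulr_ge0 ?invr_ge0 ?(ltW Np)// sumr_ge0.
  have := @power_mean R _ q k; rewrite card_mask -/N => /(_ _ q0) h.
  apply: le_trans (h _) _; first by rewrite /N expn_gt0.
  rewrite ler_pdivrMl//; apply: le_trans trace_bound.
  by apply: ler_sum => S _; apply: sqnorm_pow_le_dilation; rewrite sqnormE y1.
rewrite fdotZl fdotZr mulrA -expr2.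
apply: (@le_trans _ _ ((4 / N%:R) ^+ 2 * (N%:R * \sum_S q S))).
  rewrite ler_wpM2l ?sqr_ge0//; apply: le_trans (fdot_sum_le _) _.
  by rewrite card_mask /q; under [X in _ <= _ * X]eq_bigr do rewrite sqnormE.
have -> : (4 / N%:R) ^+ 2 * (N%:R * \sum_S q S) = 16 * (N%:R^-1 * \sum_S q S).
  by field; rewrite gt_eqF.
by rewrite exprMn (_ : 4 ^+ 2 = 16) ?ler_pM2l//; ring.
Qed.

(** Each mixed term contains V = v0 v0^T and so has rank at most one: its Frobenius norm is that of
    the contracted noise applied to Y v0 or Y^T v0, vectors of norm at most 1. *)
Lemma spiked_noise_bound (y : 'cV[R]_(n * n)) : fdot y y = 1 ->
  fdot (M *m y - (tau ^+ 2 * fdot spike y) *: spike)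
       (M *m y - (tau ^+ 2 * fdot spike y) *: spike) <= kap ^+ 2.
Proof.
move=> y1; rewrite -fdot_fold fold_spiked_noise; set Y := fold_vec y.
have Y1 : fdot Y Y = 1 by rewrite fdot_fold.
have tb0 : 0 <= tau * b by rewrite mulr_ge0// ltW.
have Yv0 : fdot (Y *m v0) (Y *m v0) <= 1.
  by apply: le_trans (fdot_mul_le _ _) _; rewrite -(sqnormE v0) v01 Y1 mulr1.
have Ytv0 : fdot (Y^T *m v0) (Y^T *m v0) <= 1.
  by apply: le_trans (fdot_mul_le _ _) _; rewrite -(sqnormE v0) v01 fdot_tr Y1 mulr1.
have v0r m (z : 'M[R]_(m, 1)) : fdot (z *m v0^T) (z *m v0^T) = fdot z z.
  by rewrite fdot_mulr trmxK -mulmxA v0v0 mulmx1.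
have -> : kap = tau * b + tau * b + n%:R * D + 4 * t by rewrite /kap; ring.
apply: fdot_triangle; rewrite ?addr_ge0 ?mulr_ge0 ?(ltW tau0)//.
  apply: fdot_triangle; rewrite ?addr_ge0 ?mulr_ge0 ?(ltW tau0)//.
    apply: fdot_triangle => //.
      rewrite fdotZl fdotZr mulrA -expr2 exprMn ler_wpM2l ?sqr_ge0//.
      rewrite -fdot_tr !trmx_mul !trmxK mulmxA mulmxA v0r -mulmxA.
      exact: noise_bound.
    rewrite fdotZl fdotZr mulrA -expr2 exprMn ler_wpM2l ?sqr_ge0//.
    rewrite /V mulmxA v0r -mulmxA; exact: noise_bound.
  by apply: le_trans (diagonal_part_bound _ D0 diag_bound) _; rewrite Y1 mulr1.
by rewrite -fold_vecZ fdot_fold; exact: decoupled_average_bound.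
Qed.

(** The correlation of v' with the spike is the quadratic form of its folding at v0, which links the
    two perturbation bounds; 8 is the product of their constants 4 and 2. *)
Lemma deterministic_recovery (v' : 'cV[R]_(n * n)) (v : 'cV[R]_n) :
  top_singular_vector M v' -> top_singular_vector (fold_vec v') v ->
  1 - 8 * (kap / tau ^+ 2) <= dotv v v0 ^+ 2.
Proof.
move=> hv' hv.
have kap0 : 0 <= kap by rewrite /kap !addr_ge0 ?mulr_ge0// ltW.
have tau2 : 0 < tau ^+ 2 by rewrite exprn_gt0.
have ME y : M *m y = (tau ^+ 2 * fdot spike y) *: spike +
    (M *m y - (tau ^+ 2 * fdot spike y) *: spike) by rewrite addrC subrK.
have [v'1 hx] : sqnorm v' = 1 /\ 1 - 4 * (kap / tau ^+ 2) <= fdot spike v' ^+ 2.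
  case: hv' => s [u] [] h.
    have [_ h2] := spiked_singular_pair ME spiked_noise_bound tau2 kap0 sqnorm_spike h.
    by case: h.
  have [h1 _] := spiked_singular_pair ME spiked_noise_bound tau2 kap0 sqnorm_spike h.
  by case: h.
have -> : 8 * (kap / tau ^+ 2) = 2 * (4 * (kap / tau ^+ 2)) by ring.
apply: (fold_singular_vector _ _ v01 _ hv).
- by rewrite mulr_ge0// divr_ge0// ltW.
- by rewrite fdot_fold -sqnormE.
- apply: le_trans hx _; rewrite -fdot_fold fold_spike /V le_eqVlt; apply/orP; left; apply/eqP.
  by congr (_ ^+ 2); rewrite fdot_mulr trmxK fdotC.
Qed.

End DeterministicRecovery.

(** * Concentration of the noise *)

Section MeasurableMatrices.
Context d (Omega : measurableType d) (R : realType).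

Definition mx_measurable m n (F : Omega -> 'M[R]_(m, n)) :=
  forall i j, measurable_fun setT (fun w => F w i j).

Lemma mx_measurable_mul m n p (F : Omega -> 'M[R]_(m, n)) (G : Omega -> 'M[R]_(n, p)) :
  mx_measurable F -> mx_measurable G -> mx_measurable (fun w => F w *m G w).
Proof.
move=> mF mG i j; rewrite (_ : (fun w => _) = (fun w => \sum_k F w i k * G w k j)).
  by apply: measurable_sum => k; exact: measurable_funM.
by apply/funext => w; rewrite mxE.
Qed.

Lemma mx_measurable_exp n (F : Omega -> 'M[R]_n) p :
  mx_measurable F -> mx_measurable (fun w => F w ^+ p).
Proof.
move=> mF; elim: p => [|p IH].
  by move=> i j; under eq_fun do rewrite expr0; exact: measurable_cst.
have -> : (fun w => F w ^+ p.+1) = (fun w => F w *m F w ^+ p).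
  by apply/funext => w; rewrite exprS.
exact: mx_measurable_mul.
Qed.

Lemma mx_measurable_sum m n (I : finType) (F : I -> Omega -> 'M[R]_(m, n)) :
  (forall i, mx_measurable (F i)) -> mx_measurable (fun w => \sum_i F i w).
Proof.
move=> mF i j; under eq_fun do rewrite summxE.
by apply: measurable_sum => k; exact: mF.
Qed.

Lemma mx_measurable_dilation n (F : Omega -> 'M[R]_n) :
  mx_measurable F -> mx_measurable (fun w => dilation (F w)).
Proof.
move=> mF i j; case: (split_ordP i) => i' ->; case: (split_ordP j) => j' ->.
- by under eq_fun do rewrite block_mxEul mxE; exact: measurable_cst.
- by under eq_fun do rewrite block_mxEur; exact: mF.
- by under eq_fun do rewrite block_mxEdl mxE; exact: mF.
- by under eq_fun do rewrite block_mxEdr mxE; exact: measurable_cst.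
Qed.

Lemma mx_measurable_kron n (F G : Omega -> 'M[R]_n) :
  mx_measurable F -> mx_measurable G -> mx_measurable (fun w => kron (F w) (G w)).
Proof.
move=> mF mG x y; case: (mxvec_indexP x) => i j; case: (mxvec_indexP y) => i' j'.
by under eq_fun do rewrite kronE; apply: measurable_funM; [exact: mF | exact: mG].
Qed.

Lemma measurable_fdot m n (F G : Omega -> 'M[R]_(m, n)) :
  mx_measurable F -> mx_measurable G -> measurable_fun setT (fun w => fdot (F w) (G w)).
Proof.
move=> mF mG; under eq_fun do rewrite fdotE.
apply: measurable_sum => i; apply: measurable_sum => j.
by apply: measurable_funM; [exact: mF | exact: mG].
Qed.

End MeasurableMatrices.

(** * Moments of the decoupled noise, averaged over signs and masks *)

Section TraceTail.
Context d (Omega : measurableType d) (R : realType) (P : probability Omega R) (n : nat).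
Local Notation I3 := ('I_n * 'I_n * 'I_n)%type.
Local Notation mask := {ffun 'I_n * 'I_n -> bool}.
Local Notation tensor := (g_sigma_algebraType (@box_system R I3)).
Variable X : I3 -> {RV P >-> R}.
Hypothesis indepX : mutually_independent X.
Hypothesis gX : forall i, std_gaussian (X i).

Definition trace_moment p (S : mask) (x : I3 -> R) : R :=
  fdot (dilation (decoupled S x) ^+ p) (dilation (decoupled S x) ^+ p).

Lemma trace_moment_ge0 p S x : 0 <= trace_moment p S x.
Proof. exact: fdot_ge0. Qed.

Lemma measurable_trace_moment p S : measurable_fun [set: tensor] (trace_moment p S : tensor -> R).
Proof.
have m_slice S' i : mx_measurable (fun x : tensor => masked_slice S' x i).
  move=> j k.
  have -> : (fun x : tensor => masked_slice S' x i j k) =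
      (fun x : tensor => (S' (j, k))%:R * x (i, j, k)) by apply/funext => x; rewrite mxE.
  by apply: measurable_funM => //; exact: measurable_coordinate.
apply: measurable_fdot; apply: mx_measurable_exp; apply: mx_measurable_dilation;
  apply: mx_measurable_sum => i; apply: mx_measurable_kron; exact: m_slice.
Qed.

Variables (r q : R) (G : set tensor).
Hypotheses (r0 : 0 <= r) (q0 : 0 <= q) (mG : measurable G).
Hypothesis G_bounds : forall x : tensor, G x ->
  fiber_bound r x /\ forall S, masked_op_bound q S x.

(** Fiber norms depend only on squares, and flips inside the mask do not touch the complement. *)
Lemma flip_masked_bounds S s (x : I3 -> R) :
  G (flip_masked S s x) -> fiber_bound r x /\ masked_op_bound q (compl_mask S) x.
Proof.
move=> /G_bounds [[h1 h2] /(_ (compl_mask S)) [h3 h4]].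
have sq t : flip_masked S s x t ^+ 2 = x t ^+ 2.
  by rewrite /flip_masked exprMn sqrr_sign mul1r.
have off i j k : (compl_mask S (j, k))%:R * flip_masked S s x (i, j, k) =
    (compl_mask S (j, k))%:R * x (i, j, k).
  rewrite /flip_masked ffunE /=; case: (S (j, k)); rewrite ?mul0r//.
  by rewrite andbF expr0 !mul1r.
split; split.
- by move=> i j; apply: le_trans (h1 i j); apply: ler_sum => k _; rewrite sq.
- by move=> i k; apply: le_trans (h2 i k); apply: ler_sum => j _; rewrite sq.
- move=> y; apply: le_trans (h3 y); apply: ler_sum => i _; apply: ler_sum => j _.
  by under [X in _ <= X ^+ 2]eq_bigr do rewrite off.
- move=> y; apply: le_trans (h4 y); apply: ler_sum => i _; apply: ler_sum => k _.
  by under [X in _ <= X ^+ 2]eq_bigr do rewrite off.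
Qed.

Let bound p : R := (4 * p%:R * (r * q)) ^+ p * (n * n + n * n)%:R.

(** Every flip preserves the joint law, so 2^#|I3| times the integral is the integral of the sum
    over all flips, which the Rademacher bound controls pointwise with the entries frozen. *)
Lemma trace_moment_integral p S :
  (\int[P]_w (\1_G (fun t => X t w) * trace_moment p S (fun t => X t w))%:E <= (bound p)%:E)%E.
Proof.
pose F (x : tensor) : R := \1_G x * trace_moment p S x.
have mF : measurable_fun setT F.
  by apply: measurable_funM; [exact: measurable_indic | exact: measurable_trace_moment].
have F0 x : 0 <= F x by rewrite mulr_ge0// trace_moment_ge0.
rewrite -[leLHS]/(\int[P]_w (F (fun t => X t w))%:E)%E.
have inv (s : {ffun I3 -> bool}) : (\int[P]_w (F (fun t => X t w))%:E =
    \int[P]_w (F (flip_masked S s (fun t => X t w)))%:E)%E.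
  rewrite (integral_sign_invariant indepX gX [ffun t => s t && S (t.1.2, t.2)] mF F0).
  apply: eq_integral => w _; congr (F _)%:E; apply/funext => t.
  by rewrite ffunE.
have mFf (s : {ffun I3 -> bool}) : measurable_fun setT
    (fun w => (F (flip_masked S s (fun t => X t w)))%:E : \bar R).
  apply/measurable_EFinP; apply: (measurableT_comp mF).
  pose Y t := signed_rv X [ffun t => s t && S (t.1.2, t.2)] t.
  rewrite (_ : (fun w => _) = (fun w => (fun t => Y t w))); first exact: measurable_family.
  apply/funext => w; apply/funext => t.
  by rewrite /Y signed_rvE ffunE.
have N0 : 0 < (2 ^ #|{: I3}|)%:R :> R by rewrite ltr0n expn_gt0.
rewrite -(@lee_pmul2l _ (2 ^ #|{: I3}|)%:R%:E)//.
have -> : ((2 ^ #|{: I3}|)%:R%:E * \int[P]_w (F (fun t => X t w))%:E =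
   \sum_(s : {ffun I3 -> bool}) \int[P]_w (F (flip_masked S s (fun t => X t w)))%:E)%E.
  rewrite -(eq_bigr _ (fun s _ => inv s)) big_const card_ffun card_bool.
  set c := (\int[P]_w _)%E; elim: (2 ^ _)%N => [|m IH] /=; first by rewrite mul0e.
  rewrite -natr1 EFinD ge0_muleDl ?lee_fin// mul1e IH addeC//.
rewrite -ge0_integral_sum//; last by move=> s w _; rewrite lee_fin.
apply: (@le_trans _ _ (\int[P]_w ((2 ^ #|{: I3}|)%:R%:E * (bound p)%:E))%E); last first.
  rewrite integral_cst// -[leRHS]mule1 le_eqVlt; apply/orP; left; apply/eqP.
  by congr (_ * _)%E; exact: probability_setT.
apply: ge0_le_integral => //.
- by move=> w _; apply: sume_ge0 => s _; rewrite lee_fin.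
- exact: emeasurable_sum.
move=> w _; rewrite sumEFin -EFinM lee_fin mulrC.
set x : I3 -> R := fun t => X t w.
have bound0 : 0 <= bound p by rewrite /bound mulr_ge0// exprn_ge0// !mulr_ge0.
(* [G] itself may change under flips. If one flip lies in [G], the bounds it yields already hold for
   x and thus serve all sign patterns; if none does, every term is 0. *)
have [[s0 Gs0]|nG] := pselect (exists s, G (flip_masked S s x)).
  have [hr hq] := flip_masked_bounds Gs0.
  apply: le_trans (decoupled_khintchine p r0 q0 hr hq).
  apply: ler_sum => s _; rewrite /F ler_piMl ?fdot_ge0//.
rewrite big1 => [|s _]; first by apply: mulr_ge0.
rewrite /F indicE memNset ?mul0r// => Gs.
by apply: nG; exists s.
Qed.

(** Markov's inequality is applied to the sum over all masks at once, so that the factor 2^(n^2)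
    cancels; a union over masks would keep it. *)
Lemma trace_tail p u : 0 < u ->
  (P [set w | ((2 ^ (n * n))%:R * u <=
       \1_G (fun t => X t w) * \sum_(S : mask) trace_moment p S (fun t => X t w))%R]
     <= (bound p / u)%:E)%E.
Proof.
move=> u0.
have N0 : 0 < (2 ^ (n * n))%:R :> R by rewrite ltr0n expn_gt0.
have mXt : @measurable_fun _ _ Omega tensor setT (fun w => (fun t => X t w)).
  exact: measurable_family.
have mT S : measurable_fun setT (fun w => \1_G (fun t => X t w) * trace_moment p S (fun t => X t w)).
  apply: measurable_funM.
    by apply: (measurableT_comp _ mXt); exact: measurable_indic.
  by apply: (measurableT_comp _ mXt); exact: measurable_trace_moment.
have -> : bound p / u = ((2 ^ (n * n))%:R * bound p) / ((2 ^ (n * n))%:R * u).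
  by field; rewrite !gt_eqF.
under [X in P X]eq_set do rewrite mulr_sumr.
apply: markov_ge0.
- by apply: measurable_sum => S.
- by move=> w; apply: sumr_ge0 => S _; rewrite mulr_ge0// trace_moment_ge0.
- by rewrite mulr_gt0.
under eq_integral do rewrite -sumEFin.
rewrite ge0_integral_sum//; last 2 first.
- by move=> S; apply/measurable_EFinP.
- by move=> S w _; rewrite lee_fin mulr_ge0// trace_moment_ge0.
apply: (@le_trans _ _ (\sum_(S : mask) (bound p)%:E)%E).
  by apply: lee_sum => S _; exact: trace_moment_integral.
rewrite sumEFin sumr_const card_ffun card_bool card_prod card_ord.
by rewrite -[X in (X%:E <= _)%E]mulr_natl.
Qed.

End TraceTail.

Section Numerics.
Variable R : realType.

Lemma expR1_ge2 : 2 <= expR 1 :> R.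
Proof. by have := expR_ge1Dx (1 : R); lra. Qed.

Lemma expR1_le4 : expR 1 <= 4 :> R.
Proof.
have h : 1/2 <= expR (- (1/2)) :> R by have := expR_ge1Dx (- (1/2) : R); lra.
have h2 : expR (1/2) <= 2 :> R.
  have : expR (1/2) * expR (- (1/2)) = 1 :> R by rewrite -expRD subrr expR0.
  have := expR_gt0 (1/2 : R); nra.
have -> : 1 = 1/2 + 1/2 :> R by field.
by rewrite expRD; have := expR_gt0 (1/2 : R); nra.
Qed.

Lemma pow2_le_expR m : (2 ^ m)%:R <= expR m%:R :> R.
Proof.
rewrite natrX -[m%:R]mulr1 expRM_natl; apply: lerXn2r; rewrite ?nnegrE ?expR_ge0//.
exact: expR1_ge2.
Qed.

(** Supplies a moment exponent that is a power of two and within a factor 2 of log n. *)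
Lemma dyadic_between (L : R) (N : nat) : 1 <= L -> L <= N%:R ->
  exists k : nat, L <= (2 ^ k)%:R /\ (2 ^ k)%:R <= 2 * L.
Proof.
move=> L1 LN.
have ex : exists k : nat, L <= (2 ^ k)%:R.
  by exists N; apply: le_trans LN _; rewrite ler_nat ltnW// ltn_expl.
case: (ex_minnP ex) => -[|k] hk hmin; first by exists 0%N; split=> //; rewrite expn0; lra.
exists k.+1; split=> //; have : ~~ (L <= (2 ^ k)%:R).
  by apply/negP => /hmin; rewrite ltnn.
rewrite -ltNge expnS natrM => h; lra.
Qed.

End Numerics.

(** * Failure probabilities of the individual noise bounds *)

Section Tails.
Context d (Omega : measurableType d) (R : realType) (P : probability Omega R).
Variables (I : finType) (X : I -> {RV P >-> R}).
Hypothesis indepX : mutually_independent X.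
Hypothesis gX : forall i, std_gaussian (X i).

Lemma square_sum_tail_inj (K : finType) (h : K -> I) (lam t : R) :
  injective h -> `|lam| <= 1/4 ->
  (P [set w | (t <= lam * \sum_k (X (h k) w ^+ 2 - 1))%R] <=
   (expR (4 * lam ^+ 2 * #|K|%:R - t))%:E)%E.
Proof.
move=> hi l1; pose D := (h @: [set: K])%SET.
have := square_sum_tail indepX gX (mem D) t l1.
rewrite (_ : #|mem D| = #|K|); last by rewrite -[LHS]/#|D| card_imset// cardsT.
congr (P _ <= _)%E; apply/seteqP; split => w /=; rewrite big_imset /=; try by move=> x y _ _; exact: hi.
  by under eq_bigl do rewrite inE.
by under [X in _ -> _ <= _ * X]eq_bigl do rewrite inE.
Qed.

Lemma measurable_square_sum (K : finType) (h : K -> I) (lam : R) :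
  measurable_fun setT (fun w => lam * \sum_k (X (h k) w ^+ 2 - 1)).
Proof.
apply: measurable_funM => //; apply: measurable_sum => k.
by apply: measurable_funB => //; exact: measurable_funX.
Qed.

(* 91 = 73 + 8 + 10: union bound over at most 2^(73 s^2) forms, variance
   term of the moment generating function at lambda = s, and final exponent. *)
Lemma linear_family_tail (T : finType) (c : T -> I -> R) (m : nat) (s : R) :
  (#|T| <= 2 ^ m)%N -> (forall a, \sum_i c a i ^+ 2 <= 16) -> 0 < s -> m%:R <= 73 * s ^+ 2 ->
  measurable [set w | exists a, (91 * s <= \sum_i c a i * X i w)%R] /\
  (P [set w | exists a, (91 * s <= \sum_i c a i * X i w)%R] <=
    (expR (- (10 * s ^+ 2)))%:E)%E.
Proof.
move=> Tm c16 s0 ms.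
have mE a : measurable [set w | (91 * s <= \sum_i c a i * X i w)%R].
  exact/measurable_ge_set/measurable_linear_form.
split; first exact: measurable_exists.
apply: (le_trans (union_bound mE (fun a => linear_form_tail indepX gX (91 * s) (c16 a) s0))).
rewrite lee_fin; apply: (@le_trans _ _ (expR m%:R * expR (s ^+ 2 * 16 / 2 - s * (91 * s)))).
  apply: ler_wpM2r; first exact: expR_ge0.
  by apply: le_trans (pow2_le_expR _ _); rewrite ler_nat.
by rewrite -expRD ler_expR; lra.
Qed.

End Tails.

Section TensorEvents.
Context d (Omega : measurableType d) (R : realType) (P : probability Omega R) (n : nat).
Local Notation I3 := ('I_n * 'I_n * 'I_n)%type.
Local Notation mask := {ffun 'I_n * 'I_n -> bool}.
Local Notation tensor := (g_sigma_algebraType (@box_system R I3)).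
Variable X : I3 -> {RV P >-> R}.
Hypothesis indepX : mutually_independent X.
Hypothesis gX : forall i, std_gaussian (X i).
Hypothesis n4 : (4 <= n)%N.
Local Notation nR := (n%:R : R).
Local Notation L := (ln nR).

Let n0 : 0 < nR. Proof. by rewrite ltr0n; lia. Qed.

Lemma ln_dim_ge1 : 1 <= L.
Proof.
rewrite -(@ler_expR R) lnK ?posrE//; apply: le_trans (@expR1_le4 R) _.
by rewrite ler_nat.
Qed.

Lemma ln_dim_le : L <= nR.
Proof. exact/ltW/ln_sublinear. Qed.

Definition tail_prob : R := (nR ^+ 10)^-1.

Lemma tail_probE : expR (- (10 * L)) = tail_prob.
Proof. by rewrite expRN -[10]/(10%:R) expRM_natl lnK ?posrE. Qed.

Lemma nR2E : nR ^+ 2 = expR (2 * L).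
Proof. by rewrite -[2 in RHS]/(2%:R) expRM_natl lnK ?posrE. Qed.

(** Centring turns 50 n into 49 n. At lam = 1/4 the exponent is n/4 - 49n/4 = -12 n <= -12 log n,
    and the union over n^2 fibers costs 2 log n. The map [h] lets one statement serve fibers in both
    directions. *)
Lemma fiber_tail (h : 'I_n * 'I_n -> 'I_n -> I3) :
  (forall u, injective (h u)) ->
  measurable [set w | exists u, (50 * nR <= \sum_k X (h u k) w ^+ 2)%R] /\
  (P [set w | exists u, (50 * nR <= \sum_k X (h u k) w ^+ 2)%R] <= tail_prob%:E)%E.
Proof.
move=> hi.
have e u : [set w | (50 * nR <= \sum_k X (h u k) w ^+ 2)%R] =
    [set w | (49/4 * nR <= 1/4 * \sum_k (X (h u k) w ^+ 2 - 1))%R].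
  apply/seteqP; split => w /=; rewrite sumrB sumr_const card_ord => h0; lra.
have mE u : measurable [set w | (50 * nR <= \sum_k X (h u k) w ^+ 2)%R].
  by rewrite e; exact/measurable_ge_set/measurable_square_sum.
have tail u : (P [set w | (50 * nR <= \sum_k X (h u k) w ^+ 2)%R] <= (expR (- (12 * L)))%:E)%E.
  rewrite e; apply: le_trans (square_sum_tail_inj indepX gX _ (hi u) _) _.
    by rewrite ger0_norm//; lra.
  rewrite lee_fin ler_expR card_ord; have := ln_dim_le; lra.
split; first exact: measurable_exists.
apply: (le_trans (union_bound mE tail)).
rewrite lee_fin card_prod card_ord natrM -expr2 nR2E -expRD -tail_probE ler_expR; lra.
Qed.

(** Chernoff parameter for a sum of n centred squares at deviation of order sqrt(n log n): it makes
    the variance term 4 mu^2 n equal to log n / 4. *)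
Let mu : R := Num.sqrt (L / nR) / 4.

Let mu_facts : [/\ 0 < mu, mu <= 1/4, mu ^+ 2 = L / (16 * nR) & mu * Num.sqrt (nR * L) = L / 4].
Proof.
have L0 : 0 < L by have := ln_dim_ge1; lra.
have Ln0 : 0 < L / nR by rewrite divr_gt0.
split.
- by rewrite divr_gt0// sqrtr_gt0.
- rewrite ler_pM2r ?invr_gt0// -[leRHS]sqrtr1 ler_wsqrtr// ler_pdivrMr// mul1r.
  exact: ln_dim_le.
- rewrite exprMn sqr_sqrtr; last exact: ltW.
  by field; rewrite gt_eqF.
- rewrite /mu mulrAC -sqrtrM; last exact: ltW.
  rewrite (_ : L / nR * (nR * L) = L ^+ 2); last by field; rewrite gt_eqF.
  by rewrite sqrtr_sqr ger0_norm// ltW.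
Qed.

(** The boolean selects the upper or lower tail, and 49/4 log n is mu times 49 sqrt(n log n). Each
    event has exponent at most (1 - 49)/4 log n = -12 log n, and there are 2 n^2 of them. *)
Definition diag_bad : set Omega := [set w | exists u : 'I_n * 'I_n * bool,
   49/4 * L <= ((-1) ^+ u.2 * mu) * \sum_i (X (i, u.1.1, u.1.2) w ^+ 2 - 1)].

Lemma diag_tail : measurable diag_bad /\ (P diag_bad <= (2 * tail_prob)%:E)%E.
Proof.
have [mu0 mu1 mu2 _] := mu_facts.
have hi (u : 'I_n * 'I_n * bool) : injective (fun i => (i, u.1.1, u.1.2) : I3).
  by move=> i j [].
have mE (u : 'I_n * 'I_n * bool) : measurable [set w |
   49/4 * L <= ((-1) ^+ u.2 * mu) * \sum_i (X (i, u.1.1, u.1.2) w ^+ 2 - 1)].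
  exact: (measurable_ge_set _ (measurable_square_sum X (fun i => (i, u.1.1, u.1.2)) _)).
have tail (u : 'I_n * 'I_n * bool) : (P [set w | (49/4 * L <= ((-1) ^+ u.2 * mu) * \sum_i (X (i, u.1.1, u.1.2) w ^+ 2 - 1))%R]
    <= (expR (- (12 * L)))%:E)%E.
  have l1 : `|(-1) ^+ u.2 * mu| <= 1/4.
    by rewrite normrM normrX normrN1 expr1n (gtr0_norm mu0) (mul1r mu).
  apply: (le_trans (square_sum_tail_inj indepX gX (49/4 * L) (hi u) l1)).
  rewrite lee_fin ler_expR card_ord exprMn sqrr_sign mul1r mu2.
  rewrite (_ : 4 * (L / (16 * nR)) * nR = L / 4); last by field; rewrite gt_eqF.
  lra.
split; first exact: measurable_exists.
apply: (le_trans (union_bound mE tail)).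
have e2 : nR * nR = expR (2 * L) by rewrite -expr2 nR2E.
rewrite lee_fin !card_prod card_ord card_bool !natrM e2 (mulrC _ 2%:R) -mulrA -expRD.
by rewrite ler_pM2l// -tail_probE ler_expR; lra.
Qed.

Lemma diag_good w : ~ diag_bad w -> forall j l,
  `|\sum_i (X (i, j, l) w ^+ 2 - 1)| <= 49 * Num.sqrt (nR * L).
Proof.
have [mu0 mu1 _ muL] := mu_facts.
move=> good j l; rewrite -(@ler_pM2l _ mu)// mulrCA muL.
have h (b : bool) : (-1) ^+ b * mu * (\sum_i (X (i, j, l) w ^+ 2 - 1)) <= 49/4 * L.
  by rewrite leNgt; apply/negP => hb; apply: good; exists (j, l, b); exact: ltW.
have := h true; have := h false; rewrite /= expr0 expr1 mul1r mulN1r.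
move=> h1 h2; rewrite -{1}(gtr0_norm mu0) -normrM ler_norml; apply/andP; split; lra.
Qed.

End TensorEvents.

Lemma sum_double (V : nmodType) (I J : finType) (F : I * J -> V) :
  \sum_t F t = \sum_i \sum_j F (i, j).
Proof. by rewrite pair_big; apply: eq_bigr => -[i j]. Qed.

Section NetForms.
Variables (R : realType) (n : nat).
Local Notation I3 := ('I_n * 'I_n * 'I_n)%type.
Local Notation mask := {ffun 'I_n * 'I_n -> bool}.
Variables (T1 T2 : finType) (f1 : T1 -> 'I_n -> R) (f2 : T2 -> 'I_n * 'I_n -> R).
Hypothesis f1_le : forall a, \sum_j f1 a j ^+ 2 <= 4.
Hypothesis f2_le : forall a, \sum_j f2 a j ^+ 2 <= 4.
Hypothesis f1_net : forall x : 'I_n -> R, \sum_j x j ^+ 2 <= 1 ->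
  exists a, \sum_j (x j - f1 a j) ^+ 2 <= 1/16.
Hypothesis f2_net : forall x : 'I_n * 'I_n -> R, \sum_j x j ^+ 2 <= 1 ->
  exists a, \sum_j (x j - f2 a j) ^+ 2 <= 1/16.

(** Value of a masked flattening at a pair of net points, written as the coefficients of one
    Gaussian linear form, so that a single union bound covers masks and both nets. *)
Definition row_form (u : mask * T1 * T2) (t : I3) : R :=
  f1 u.1.2 t.2 * f2 u.2 t.1 * (u.1.1 (t.1.2, t.2))%:R.
Definition col_form (u : mask * T1 * T2) (t : I3) : R :=
  f1 u.1.2 t.1.2 * f2 u.2 (t.1.1, t.2) * (u.1.1 (t.1.2, t.2))%:R.
Definition contracted_form (v0 : 'cV[R]_n) (u : T1 * T1) (t : I3) : R :=
  v0 t.1.1 0 * (f1 u.1 t.2 * f1 u.2 t.1.2).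

Let mask_sq (x : R) (b : bool) : (x * b%:R) ^+ 2 <= x ^+ 2.
Proof. by case: b; rewrite ?mulr1// mulr0 expr0n /= sqr_ge0. Qed.

Let prod_le16 (x y : R) : 0 <= x -> 0 <= y -> x <= 4 -> y <= 4 -> x * y <= 16.
Proof. by move=> x0 y0 x4 y4; nra. Qed.

Lemma row_form_sq u : \sum_t row_form u t ^+ 2 <= 16.
Proof.
apply: le_trans (ler_sum _ (fun t _ => mask_sq _ _)) _.
have -> : \sum_(t : I3) (f1 u.1.2 t.2 * f2 u.2 t.1) ^+ 2 =
    (\sum_ij f2 u.2 ij ^+ 2) * (\sum_k f1 u.1.2 k ^+ 2).
  rewrite mulr_suml; under [RHS]eq_bigr do rewrite mulr_sumr.
  by rewrite pair_big /=; apply: eq_bigr => -[ij k] _ /=; rewrite exprMn mulrC.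
by apply: prod_le16 => //; apply: sumr_ge0 => ? _; exact: sqr_ge0.
Qed.

Lemma col_form_sq u : \sum_t col_form u t ^+ 2 <= 16.
Proof.
apply: le_trans (ler_sum _ (fun t _ => mask_sq _ _)) _.
have -> : \sum_(t : I3) (f1 u.1.2 t.1.2 * f2 u.2 (t.1.1, t.2)) ^+ 2 =
    (\sum_ik f2 u.2 ik ^+ 2) * (\sum_j f1 u.1.2 j ^+ 2).
  rewrite sum_triple mulr_suml [RHS]sum_double.
  apply: eq_bigr => i _; rewrite exchange_big; apply: eq_bigr => k _.
  by rewrite mulr_sumr; apply: eq_bigr => j _; rewrite exprMn mulrC.
by apply: prod_le16 => //; apply: sumr_ge0 => ? _; exact: sqr_ge0.
Qed.

Lemma contracted_form_sq v0 u : sqnorm v0 = 1 -> \sum_t contracted_form v0 u t ^+ 2 <= 16.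
Proof.
move=> v01.
have -> : \sum_t contracted_form v0 u t ^+ 2 =
    (\sum_i v0 i 0 ^+ 2) * ((\sum_k f1 u.1 k ^+ 2) * (\sum_j f1 u.2 j ^+ 2)).
  rewrite sum_triple mulr_suml; apply: eq_bigr => i _.
  rewrite mulrA mulr_sumr; apply: eq_bigr => j _.
  rewrite mulr_sumr mulr_suml; apply: eq_bigr => k _.
  by rewrite /contracted_form /= !exprMn; ring.
rewrite -/(sqnorm v0) v01 mul1r.
by apply: prod_le16 => //; apply: sumr_ge0 => ? _; exact: sqr_ge0.
Qed.

Lemma masked_op_bound_of_net (x : I3 -> R) t S :
  (forall u, \sum_i row_form u i * x i <= t) ->
  (forall u, \sum_i col_form u i * x i <= t) ->
  masked_op_bound ((4 * t) ^+ 2) S x.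
Proof.
move=> hr hc; split=> y.
- pose B (k : 'I_n) (ij : 'I_n * 'I_n) := (S (ij.2, k))%:R * x (ij, k).
  have := @bilinear_net_bound R _ _ B _ _ f1 f2 t f1_le f1_net f2_net _ y.
  have -> : \sum_i \sum_j (\sum_k (S (j, k))%:R * x (i, j, k) * y k) ^+ 2 =
      \sum_ij (\sum_k y k * B k ij) ^+ 2.
    rewrite pair_big; apply: eq_bigr => -[i j] _; congr (_ ^+ 2).
    by apply: eq_bigr => k _; rewrite mulrC.
  apply => a b; apply: le_trans (hr (S, a, b)); rewrite le_eqVlt; apply/orP; left; apply/eqP.
  rewrite exchange_big pair_big; apply: eq_bigr => -[ij k] _ /=.
  by rewrite /row_form /B /=; ring.
- pose B (j : 'I_n) (ik : 'I_n * 'I_n) := (S (j, ik.2))%:R * x (ik.1, j, ik.2).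
  have := @bilinear_net_bound R _ _ B _ _ f1 f2 t f1_le f1_net f2_net _ y.
  have -> : \sum_i \sum_k (\sum_j (S (j, k))%:R * x (i, j, k) * y j) ^+ 2 =
      \sum_ik (\sum_j y j * B j ik) ^+ 2.
    rewrite pair_big; apply: eq_bigr => -[i k] _; congr (_ ^+ 2).
    by apply: eq_bigr => j _; rewrite mulrC.
  apply => a b; apply: le_trans (hc (S, a, b)); rewrite le_eqVlt; apply/orP; left; apply/eqP.
  rewrite exchange_big sum_double sum_triple.
  apply: eq_bigr => i _; rewrite exchange_big; apply: eq_bigr => j _.
  by apply: eq_bigr => k _; rewrite /col_form /B /=; ring.
Qed.

Lemma contracted_noise_of_net v0 (x : I3 -> R) t : 
  (forall u, \sum_i contracted_form v0 u i * x i <= t) ->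
  forall z : 'cV[R]_n, fdot z z <= 1 ->
    fdot (contracted_noise x v0 *m z) (contracted_noise x v0 *m z) <= (4 * t) ^+ 2.
Proof.
move=> hf z z1.
pose B (k j : 'I_n) := \sum_i v0 i 0 * x (i, j, k).
have := @bilinear_net_bound R _ _ B _ _ f1 f1 t f1_le f1_net f1_net _ (fun k => z k 0).
have E m (A : 'cV[R]_m) : fdot A A = \sum_j A j 0 ^+ 2 by rewrite -sqnormE.
rewrite -E => h.
apply: (@le_trans _ _ ((4 * t) ^+ 2 * fdot z z)); last by rewrite ler_piMr// sqr_ge0.
apply: le_trans (h _); last first.
  move=> a b; apply: le_trans (hf (a, b)); rewrite le_eqVlt; apply/orP; left; apply/eqP.
  rewrite sum_triple exchange_big /= [RHS]exchange_big /=; apply: eq_bigr => j _.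
  rewrite [RHS]exchange_big; apply: eq_bigr => k _ /=.
  rewrite /B mulr_sumr; apply: eq_bigr => i _; rewrite /contracted_form /=; ring.
rewrite E; apply: ler_sum => j _; rewrite le_eqVlt; apply/orP; left; apply/eqP.
congr (_ ^+ 2); rewrite mxE; apply: eq_bigr => k _; rewrite mulrC; congr (_ * _).
by rewrite /contracted_noise summxE; apply: eq_bigr => i _; rewrite !mxE.
Qed.

End NetForms.

(* The square of this constant is 400 * 364^2 * 4^12: by [trace_bound_ratio] this
   makes each factor of the trace moment at most 4^-12 times its threshold.
   Locking prevents the unary numeral from being evaluated. *)
Definition trace_const : nat := locked (20 * 364 * 4 ^ 6)%N.

Lemma trace_const_gt0 : (0 < trace_const)%N.
Proof. by rewrite /trace_const -lock muln_gt0 expn_gt0. Qed.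

Lemma trace_constE (R : pzSemiRingType) : trace_const%:R = 20 * 364 * 4 ^+ 6 :> R.
Proof. by rewrite /trace_const -lock natrM natrX natrM. Qed.

(** 73 = 1 + 36 + 36: the masks, the net in dimension n bounded crudely by one of dimension n^2, and
    the net in dimension n^2. *)
Lemma net_exponent n : (n * n + 36 * n + 36 * (n * n) <= 73 * (n * n))%N.
Proof.
have nn : (n <= n * n)%N by case: n => // n; rewrite leq_pmulr.
lia.
Qed.

(** * Assembly of the good event *)

Section GoodEvent.
Context d (Omega : measurableType d) (R : realType) (P : probability Omega R) (n : nat).
Local Notation I3 := ('I_n * 'I_n * 'I_n)%type.
Local Notation mask := {ffun 'I_n * 'I_n -> bool}.
Local Notation tensor := (g_sigma_algebraType (@box_system R I3)).
Variable X : I3 -> {RV P >-> R}.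
Hypothesis indepX : mutually_independent X.
Hypothesis gX : forall i, std_gaussian (X i).
Hypothesis n4 : (4 <= n)%N.
Variables (v0 : 'cV[R]_n) (v01 : sqnorm v0 = 1).
Local Notation nR := (n%:R : R).
Local Notation L := (ln nR).
Local Notation scale := (nR * Num.sqrt (nR * L)).

Let n0 : 0 < nR. Proof. by rewrite ltr0n; lia. Qed.

(** Since 1/4 <= 1/e and p >= log n, the p-th power of the ratio 4^(-12) is at most n^(-12); the
    dimension 2 n^2 of the dilation reduces this to 2 n^(-10). The bound p <= 2 log n serves to
    compare the bases. *)
Lemma trace_bound_ratio p : L <= p%:R -> p%:R <= 2 * L ->
  (4 * p%:R * (50 * nR * (4 * (91 * nR)) ^+ 2)) ^+ p * (n * n + n * n)%:R /
    ((trace_const%:R * scale) ^+ 2) ^+ p <= 2 * tail_prob R n.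
Proof.
move=> Lp pL; have L1 := (ln_dim_ge1 R n4); have L0 : 0 < L by lra.
set K : R := trace_const%:R; set t2 := (K * scale) ^+ 2.
have K0 : 0 < K by rewrite ltr0n trace_const_gt0.
have t2E : t2 = K ^+ 2 * (nR ^+ 3 * L).
  rewrite /t2 !exprMn sqr_sqrtr; last by rewrite mulr_ge0// ltW.
  by ring.
have t20 : 0 < t2.
  by rewrite t2E; apply: mulr_gt0; [exact: exprn_gt0 | apply: mulr_gt0; first exact: exprn_gt0].
rewrite ler_pdivrMr; last by rewrite exprn_gt0.
have base : 4 * p%:R * (50 * nR * (4 * (91 * nR)) ^+ 2) <= (1/4) ^+ 12 * t2.
  rewrite t2E [leRHS]mulrA (_ : (1/4) ^+ 12 * K ^+ 2 = 400 * 364 ^+ 2); last first.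
    by rewrite /K trace_constE; field.
  have c0 : 0 < 200 * 364 ^+ 2 :> R by lra.
  rewrite (_ : 4 * p%:R * _ = (200 * 364 ^+ 2) * (nR ^+ 3 * p%:R)); last by ring.
  rewrite (_ : 400 * 364 ^+ 2 * _ = (200 * 364 ^+ 2) * (nR ^+ 3 * (2 * L))); last by ring.
  by rewrite (ler_pM2l c0); apply: ler_wpM2l pL; apply: exprn_ge0; exact: ltW.
have quarter : (1/4 : R) <= expR (- 1).
  rewrite expRN mul1r lef_pV2 ?posrE ?expR_gt0//; exact: expR1_le4.
have decay : ((1/4 : R) ^+ 12) ^+ p <= expR (- (12 * L)).
  rewrite -exprM; apply: (@le_trans _ _ (expR (- 1) ^+ (12 * p))).
    by apply: lerXn2r; rewrite ?nnegrE ?expR_ge0.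
  by rewrite -expRM_natl ler_expR natrM; lra.
have pow : (4 * p%:R * (50 * nR * (4 * (91 * nR)) ^+ 2)) ^+ p <= expR (- (12 * L)) * t2 ^+ p.
  apply: (@le_trans _ _ (((1/4) ^+ 12 * t2) ^+ p)).
    have l0 : 0 <= 4 * p%:R * (50 * nR * (4 * (91 * nR)) ^+ 2).
      apply: mulr_ge0; first by apply: mulr_ge0.
      apply: mulr_ge0 (sqr_ge0 _); apply: mulr_ge0 => //; exact: ltW.
    have r0 : 0 <= (1/4) ^+ 12 * t2.
      apply: mulr_ge0; last exact: ltW.
      by apply: exprn_ge0; lra.
    by apply: lerXn2r; rewrite ?nnegrE.
  rewrite exprMn; apply: ler_wpM2r decay; apply: exprn_ge0; exact: ltW.
apply: (@le_trans _ _ (expR (- (12 * L)) * t2 ^+ p * (2 * expR (2 * L)))).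
  rewrite (_ : (n * n + n * n)%:R = 2 * expR (2 * L)); last first.
    by rewrite -(nR2E R n4) natrD natrM; ring.
  by apply: ler_wpM2r pow; apply: mulr_ge0 => //; exact: expR_ge0.
rewrite -(tail_probE R n4) (_ : - (10 * L) = - (12 * L) + 2 * L); last by ring.
by rewrite expRD le_eqVlt; apply/orP; left; apply/eqP; ring.
Qed.

Lemma measurable_forall_lt (d' : measure_display) (S : measurableType d') (T : finType)
    (F : T -> S -> R) (c : R) : (forall a, measurable_fun setT (F a)) ->
  measurable [set x | forall a, F a x < c].
Proof.
move=> mF; rewrite (_ : [set x | _] = ~` [set x | exists a, c <= F a x]).
  by apply: measurableC; apply: measurable_exists => a; exact: measurable_ge_set.
apply/seteqP; split => x /=; first by move=> h [a]; rewrite leNgt h.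
by move=> h a; rewrite ltNge; apply/negP => ha; apply: h; exists a.
Qed.

(** Seven bad events: two for fibers, two for flattenings and one for the contracted noise cost one
    [tail_prob] each, the chi-square sums and the trace moments two each, nine in all. Off the first
    four the tensor lies in [G], so the indicator inside the trace event equals 1. *)
Lemma good_event : exists E : set Omega, [/\ measurable E,
  forall w, E w ->
    [/\ forall z : 'cV[R]_n, fdot z z <= 1 ->
          fdot (contracted_noise (fun t => X t w) v0 *m z)
               (contracted_noise (fun t => X t w) v0 *m z) <= (4 * (91 * Num.sqrt nR)) ^+ 2,
        forall j l, `|\sum_i (X (i, j, l) w ^+ 2 - 1)| <= 49 * Num.sqrt (nR * L) &
        exists k, \sum_(S : mask) trace_moment (2 ^ k) S (fun t => X t w) <=
          (2 ^ (n * n))%:R * ((trace_const%:R * scale) ^+ 2) ^+ (2 ^ k)] &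
  ((1 - 9 * tail_prob R n)%:E <= P E)%E].
Proof.
have L1 := (ln_dim_ge1 R n4); have L0 : 0 < L by lra.
have [k [kL kL2]] := dyadic_between L1 (ln_dim_le R n4).
have [T1 [f1 [card1 f1_le f1_net]]] := ball_net R 'I_n.
have [T2 [f2 [card2 f2_le f2_net]]] := ball_net R ('I_n * 'I_n)%type.
rewrite card_ord in card1; rewrite card_prod card_ord in card2.
pose h1 (u : 'I_n * 'I_n) (l : 'I_n) : I3 := (u, l).
pose h2 (u : 'I_n * 'I_n) (l : 'I_n) : I3 := (u.1, l, u.2).
have [mB1 pB1] := fiber_tail indepX gX n4 (h := h1) (fun u x y => fun e => congr1 snd e).
have [mB2 pB2] := fiber_tail indepX gX n4 (h := h2)
  (fun u x y => fun e => congr1 (fun t : I3 => t.1.2) e).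
have [mB5 pB5] := diag_tail indepX gX n4.
have card3 : (#|{: mask * T1 * T2}| <= 2 ^ (73 * (n * n)))%N.
  rewrite !card_prod card_ffun card_bool card_prod card_ord.
  apply: (@leq_trans (2 ^ (n * n) * 2 ^ (36 * n) * 2 ^ (36 * (n * n)))%N).
    by apply: leq_mul => //; apply: leq_mul.
  by rewrite -!expnD; apply: leq_pexp2l => //; exact: net_exponent.
have card4 : (#|{: T1 * T1}| <= 2 ^ (72 * n))%N.
  rewrite card_prod; apply: leq_trans (leq_mul card1 card1) _.
  by rewrite -expnD -mulnDl.
have m3 : (73 * (n * n))%:R <= 73 * nR ^+ 2 by rewrite !natrM expr2.
have sn0 : 0 < Num.sqrt nR by rewrite sqrtr_gt0.
have snn : Num.sqrt nR ^+ 2 = nR by rewrite sqr_sqrtr// ltW.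
have m4 : (72 * n)%:R <= 73 * Num.sqrt nR ^+ 2 by rewrite snn natrM; have := n0; lra.
(* The scale is s = n for the flattenings, whose family has up to 2^(73 n^2) members; the contracted
   noise needs only 2^(72 n), so s = sqrt n suffices there. *)
have [mB3 pB3] := linear_family_tail indepX gX card3 (row_form_sq f1_le f2_le) n0 m3.
have [mB3' pB3'] := linear_family_tail indepX gX card3 (col_form_sq f1_le f2_le) n0 m3.
have [mB4 pB4] := linear_family_tail indepX gX card4
  (fun u => contracted_form_sq f1_le u v01) sn0 m4.
set B1 := [set w | exists u, _] in mB1 pB1; set B2 := [set w | exists u, _] in mB2 pB2.
set B3 := [set w | exists a, _] in mB3 pB3; set B3' := [set w | exists a, _] in mB3' pB3'.
set B4 := [set w | exists a, _] in mB4 pB4; set B5 := diag_bad X in mB5 pB5.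
have e3 : expR (- (10 * nR ^+ 2)) <= tail_prob R n.
  rewrite -(tail_probE R n4) ler_expR; have := (ln_dim_le R n4).
  have : nR * 1 <= nR * nR by rewrite (ler_pM2l n0) ler1n; exact: leq_trans n4.
  by rewrite expr2; lra.
have e4 : expR (- (10 * Num.sqrt nR ^+ 2)) <= tail_prob R n.
  by rewrite -(tail_probE R n4) ler_expR snn; have := (ln_dim_le R n4); lra.
(* A set of tensors rather than of outcomes, so that membership can be tested on sign-flipped
   tensors. *)
pose G : set tensor :=
  [set x | forall u, \sum_l x (h1 u l) ^+ 2 < 50 * nR] `&`
  [set x | forall u, \sum_l x (h2 u l) ^+ 2 < 50 * nR] `&`
  [set x | forall u, \sum_t row_form f1 f2 u t * x t < 91 * nR] `&`
  [set x | forall u, \sum_t col_form f1 f2 u t * x t < 91 * nR].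
have mG : measurable G.
  have mc (t : I3) := @measurable_coordinate R I3 t.
  do 3?[apply: measurableI]; apply: measurable_forall_lt => u; apply: measurable_sum => l.
  - by apply: measurable_funX; exact: mc.
  - by apply: measurable_funX; exact: mc.
  - by apply: measurable_funM => //; exact: mc.
  - by apply: measurable_funM => //; exact: mc.
pose r : R := 50 * nR; pose q : R := (4 * (91 * nR)) ^+ 2.
have G_bounds (x : tensor) : G x -> fiber_bound r x /\ forall S, masked_op_bound q S x.
  move=> [[[g1 g2] g3] g4]; split.
    by split=> i j; apply: ltW; [exact: (g1 (i, j)) | exact: (g2 (i, j))].
  move=> S; have := @masked_op_bound_of_net R n T1 T2 f1 f2 f1_le f1_net f2_net x (91 * nR) S.
  by apply=> a; apply: ltW; [exact: g3 | exact: g4].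
have r0 : 0 <= r by rewrite mulr_ge0// ltW.
have q0 : 0 <= q by exact: sqr_ge0.
pose u : R := ((trace_const%:R * scale) ^+ 2) ^+ (2 ^ k).
have c0 : 0 < trace_const%:R :> R by rewrite ltr0n trace_const_gt0.
have u0 : 0 < u by rewrite !exprn_gt0// mulr_gt0// mulr_gt0// sqrtr_gt0 mulr_gt0.
have pB6 := trace_tail indepX gX r0 q0 mG G_bounds (2 ^ k) u0.
set B6 := [set w | _] in pB6.
have mB6 : measurable B6.
  apply: measurable_ge_set; apply: measurable_funM.
    by apply: (measurableT_comp _ (measurable_family X)); exact: measurable_indic.
  apply: measurable_sum => S.
  by apply: (measurableT_comp _ (measurable_family X)); exact: measurable_trace_moment.
have {}pB6 : (P B6 <= (2 * tail_prob R n)%:E)%E.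
  by apply: le_trans pB6 _; rewrite lee_fin; exact: trace_bound_ratio.
pose Bad := B1 `|` B2 `|` B3 `|` B3' `|` B4 `|` B5 `|` B6.
have mBad : measurable Bad by rewrite /Bad; do 6?[apply: measurableU].
exists (~` Bad); split; first exact: measurableC.
- move=> w nbad.
  have nB1 : ~ B1 w by move=> b; apply: nbad; do 6 left.
  have nB2 : ~ B2 w by move=> b; apply: nbad; do 5 left; right.
  have nB3 : ~ B3 w by move=> b; apply: nbad; do 4 left; right.
  have nB3' : ~ B3' w by move=> b; apply: nbad; do 3 left; right.
  have nB4 : ~ B4 w by move=> b; apply: nbad; do 2 left; right.
  have nB5 : ~ B5 w by move=> b; apply: nbad; left; right.
  have nB6 : ~ B6 w by move=> b; apply: nbad; right.
  split; last exists k.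
  + apply: (contracted_noise_of_net f1_le f1_net) => a.
    by rewrite leNgt; apply/negP => h; apply: nB4; exists a; exact: ltW.
  + exact: diag_good nB5.
  have Gw : G (fun t => X t w).
    by split; [split; [split|]|] => a /=; rewrite ltNge; apply/negP => h;
      [apply: nB1 | apply: nB2 | apply: nB3 | apply: nB3']; exists a.
  rewrite leNgt; apply/negP => h; apply: nB6.
  by rewrite /B6 /= indicE mem_set// mul1r; exact: ltW.
rewrite probability_setC// EFinB leeB//.
have add (A B : set Omega) (x y : R) : measurable A -> measurable B ->
    (P A <= (x * tail_prob R n)%:E)%E -> (P B <= (y * tail_prob R n)%:E)%E ->
    measurable (A `|` B) /\ (P (A `|` B) <= ((x + y) * tail_prob R n)%:E)%E.
  move=> mA mB pA pB; split; first exact: measurableU.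
  by apply: le_trans (measureU2 _ mA mB) _; rewrite mulrDl EFinD leeD.
have one (A : set Omega) (x : R) : x <= tail_prob R n -> (P A <= x%:E)%E -> (P A <= (1 * tail_prob R n)%:E)%E.
  by move=> xe pA; apply: le_trans pA _; rewrite lee_fin mul1r.
have [m12 p12] := add _ _ _ _ mB1 mB2 (one _ _ (lexx _) pB1) (one _ _ (lexx _) pB2).
have [m13 p13] := add _ _ _ _ m12 mB3 p12 (one _ _ e3 pB3).
have [m14 p14] := add _ _ _ _ m13 mB3' p13 (one _ _ e3 pB3').
have [m15 p15] := add _ _ _ _ m14 mB4 p14 (one _ _ e4 pB4).
have [m16 p16] := add _ _ _ _ m15 mB5 p15 pB5.
have [m17 p17] := add _ _ _ _ m16 mB6 p16 pB6.
have f0 : 0 <= tail_prob R n by rewrite /tail_prob invr_ge0; apply: exprn_ge0; exact: ltW.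
by apply: le_trans p17 _; rewrite lee_fin; apply: ler_wpM2r; [exact: f0 | lra].
Qed.

End GoodEvent.

(** With this constant the claimed probability is nonpositive for n <= 3; it also exceeds the 9 of
    the good event. Locked to keep the unary numeral from unfolding. *)
Definition failure_const : nat := locked (4 ^ 10)%N.

(** * Signal-to-noise ratio and conclusion *)

Section Threshold.
Variables (R : realType) (n : nat) (n4 : (4 <= n)%N).
Local Notation nR := (n%:R : R).
Local Notation L := (ln nR).
Local Notation rate := ((nR `^ (3 / 4)) * (L `^ (1 / 4))).

(** Origin of the threshold: the square of the rate n^(3/4) (log n)^(1/4) is the order of the
    centred noise, to be compared with tau^2. *)
Lemma rate_sq : rate ^+ 2 = nR * Num.sqrt (nR * L).
Proof.
have n0 : 0 < nR by rewrite ltr0n; lia.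
have L0 : 0 < L by have := ln_dim_ge1 R n4; lra.
have e : nR `^ (3/4) ^+ 2 = nR * Num.sqrt nR.
  rewrite -powR_mulrn ?powR_ge0// -powRrM (_ : 3/4 * 2 = 1 + 2^-1); last by field.
  by rewrite powRD ?(gt_eqF n0) ?implybT// powRr1 ?(ltW n0)// powR12_sqrt ?(ltW n0).
have e' : L `^ (1/4) ^+ 2 = Num.sqrt L.
  rewrite -powR_mulrn ?powR_ge0// -powRrM (_ : 1/4 * 2 = 2^-1); last by field.
  by rewrite powR12_sqrt ?(ltW L0).
by rewrite exprMn e e' sqrtrM ?(ltW n0)// mulrA.
Qed.

Lemma sqrt_le_rate : Num.sqrt nR <= rate.
Proof.
have n1 : 1 <= nR by rewrite ler1n; lia.
have n0 : 0 < nR by lra.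
have L1 := ln_dim_ge1 R n4.
have r0 : 0 <= rate by rewrite mulr_ge0// powR_ge0.
rewrite -(@ler_pXn2r _ 2)// ?nnegrE// rate_sq sqr_sqrtr ?(ltW n0)//.
rewrite ler_peMr ?(ltW n0)// -[leLHS]sqrtr1 ler_wsqrtr//.
by rewrite -[leLHS]mulr1 ler_pM.
Qed.

(** With h the rate, h <= tau eps. The mixed terms use sqrt n <= h, so tau sqrt n <= tau^2 eps; the
    others use h^2 <= (tau eps)^2 <= tau^2 eps, valid as eps <= 1. Here 777 = 2 * 4 * 91 + 49. *)
Lemma signal_to_noise (eps tau : R) : 0 < eps -> eps <= 1 -> rate / eps <= tau ->
  0 < tau /\
  8 * ((2 * (tau * (4 * (91 * Num.sqrt nR))) + nR * (49 * Num.sqrt (nR * L)) +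
     4 * (trace_const%:R * (nR * Num.sqrt (nR * L)))) / tau ^+ 2) <=
  (8 * (777 + 4 * trace_const))%:R * eps.
Proof.
move=> e0 e1; rewrite ler_pdivrMr// => hr.
have rs := rate_sq; have sr := sqrt_le_rate; have n0 : 0 < nR by rewrite ltr0n; lia.
set h := _ `^ _ * _ in hr rs sr; set s := Num.sqrt nR in sr *.
have s0 : 0 < s by rewrite sqrtr_gt0.
have h0 : 0 < h by lra.
have tau0 : 0 < tau by rewrite -(pmulr_lgt0 _ e0); lra.
split=> //; set K : R := trace_const%:R.
have K0 : 0 <= K by rewrite ler0n.
rewrite (mulrCA nR) -rs natrM natrD natrM -/K.
have t2 : 0 < tau ^+ 2 by rewrite exprn_gt0.
rewrite -!mulrA ler_pM2l// ler_pdivrMr//.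
have a1 : tau * s <= tau ^+ 2 * eps.
  by rewrite expr2 -mulrA ler_pM2l//; lra.
have a2 : h ^+ 2 <= tau ^+ 2 * eps.
  apply: (@le_trans _ _ ((tau * eps) ^+ 2)); first by rewrite lerXn2r// ?nnegrE; lra.
  rewrite exprMn ler_pM2l// expr2 ler_piMr//; lra.
have a3 : K * h ^+ 2 <= K * (tau ^+ 2 * eps) by rewrite ler_wpM2l.
lra.
Qed.

End Threshold.

Theorem mainTheorem8 :
  exists C K1 K2 : nat,
  forall (R : realType) (d : measure_display) (Omega : measurableType d)
    (P : probability Omega R) (n : nat) (v0 : 'cV[R]_n) (eps tau : R)
    (A : 'I_n -> 'I_n -> 'I_n -> {RV P >-> R}),
    sqnorm v0 = 1 ->
    0 < eps ->
    C%:R * (n%:R `^ (3 / 4)) * ((ln n%:R) `^ (1 / 4)) / eps <= tau ->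
    @mutually_independent d Omega R P _ (fun t : 'I_n * 'I_n * 'I_n => A t.1.1 t.1.2 t.2) ->
    (forall i j k, @std_gaussian d Omega R P (A i j k)) ->
    exists E : set Omega,
      [/\ measurable E,
          (forall omega, E omega ->
             forall (v' : 'cV[R]_(n * n)) (v : 'cV[R]_n),
               top_singular_vector
                 (spectral_matrix (spiked_slice tau v0 (fun i j k => A i j k omega))) v' ->
               top_singular_vector (fold_vec v') v ->
               1 - K2%:R * eps <= dotv v v0 ^+ 2) &
          ((1 - K1%:R / n%:R ^+ 10)%:E <= P E)%E].
Proof.
(* C = 1 is possible because numerical losses are absorbed by the constant in front of eps. *)
exists 1%N, failure_const, (8 * (777 + 4 * trace_const))%N.
move=> R d Omega P n v0 eps tau A v01 eps0 htau indep gauss.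
have n0 : (0 < n)%N.
  case: n v0 A v01 htau indep gauss => // v0 _ v01 _ _ _; move: v01; rewrite /sqnorm big_ord0.
  by move/eqP; rewrite eq_sym oner_eq0.
(* For n <= 3 the required probability is at most 0 and the empty event will do; from n = 4 on, log
   n >= 1. *)
have [n3|n4] := leqP n 3.
  exists set0; split=> //; rewrite measure0 lee_fin subr_le0 ler_pdivlMr ?exprn_gt0 ?ltr0n//.
  by rewrite mul1r -natrX ler_nat /failure_const -lock leq_exp2r// ltnW.
have K2_ge1 : 1 <= (8 * (777 + 4 * trace_const))%:R :> R.
  by rewrite ler1n muln_gt0 addn_gt0.
(* For eps > 1 the claimed correlation is negative, so the whole space will do. *)
have [eps1|eps1] := ltP 1 eps.
  exists setT; split=> //; last first.
    rewrite (_ : P setT = 1%E); last exact: probability_setT.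
    by rewrite lee_fin lerBlDr lerDl divr_ge0// exprn_ge0.
  move=> w _ v' v _ _; apply: le_trans (sqr_ge0 _); rewrite subr_le0.
  by rewrite -[leLHS]mulr1 ler_pM// ltW.
rewrite (mul1r (_ `^ _)) in htau.
have [tau0 snr] := signal_to_noise n4 eps0 eps1 htau.
have [E [mE hE pE]] := good_event indep (fun t => gauss t.1.1 t.1.2 t.2) n4 v01.
exists E; split=> //; last first.
  apply: le_trans pE; rewrite lee_fin lerB// /tail_prob; apply: ler_wpM2r.
    by rewrite invr_ge0 exprn_ge0.
  by rewrite -[9]/(9%:R) ler_nat /failure_const -lock (@leq_trans (4 ^ 2))// leq_exp2l.
move=> w /hE [noise diag [k tr]] v' v hv' hv.
apply: le_trans (lerB (lexx 1) snr) _.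
pose a (t : 'I_n * 'I_n * 'I_n) := A t.1.1 t.1.2 t.2 w.
apply: (@deterministic_recovery R n a v0 tau v01 tau0 (4 * (91 * Num.sqrt n%:R))
  (49 * Num.sqrt (n%:R * ln n%:R)) (trace_const%:R * (n%:R * Num.sqrt (n%:R * ln n%:R))) k
  _ _ _ noise diag tr v' v hv' hv).
- by rewrite !mulr_ge0 ?sqrtr_ge0.
- by rewrite mulr_ge0 ?sqrtr_ge0.
- by rewrite !mulr_ge0 ?sqrtr_ge0.
Qed.
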